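(* Let $c\ge 0$, $d\in\{0,1,2,\dots\}$ and $\lambda>0$ be fixed, set $q=e^{-\lambda/N}$ and $\alpha=cN+d$, and let $\nu_{n,N}=\frac1n\sum_{j=1}^n\delta_{x^{(j)}_{n,N}}$ be the normalized zero counting measure of the little $q$-Laguerre polynomial $p_n(x;q^{\alpha}\,|\,q)$. Then as $n,N\to\infty$ with $n/N\to1$, for every continuous function $f$ on $[0,1]$, $\int f\,d\nu_{n,N}\to\int_0^1 f(x)\rho^{(c)}(x)\,dx$.
   Context: For $\mathsf{a}\in(0,1/q)$ the little $q$-Laguerre polynomials $p_n(x)=p_n(x;\mathsf{a}\,|\,q)$ are defined by $p_0(x)=1$, $p_1(x)=1-\frac{x}{1-\mathsf{a}q}$ and, for $n\ge1$, $q^n(1-\mathsf{a}q^{n+1})p_{n+1}(x)+\big(x-q^n(1-\mathsf{a}q^{n+1})-\mathsf{a}q^n(1-q^n)\big)p_n(x)+\mathsf{a}q^n(1-q^n)p_{n-1}(x)=0$; here $\mathsf{a}=q^{\alpha}$. $q$-deformed Marchenko–Pastur law: let $\lambda_c$ be the unique positive number with $e^{-\lambda_c}(1+e^{-c\lambda_c})=1$; put $\mathsf{s}=e^{-\lambda}$, $a=\big(\sqrt{\mathsf{s}(1-\mathsf{s}^{c+1})}-\sqrt{\mathsf{s}^{c+1}(1-\mathsf{s})}\big)^2$, $b=\big(\sqrt{\mathsf{s}(1-\mathsf{s}^{c+1})}+\sqrt{\mathsf{s}^{c+1}(1-\mathsf{s})}\big)^2$, and $\rho^{(c)}(x)=\frac{2}{\pi\lambda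 x}\arctan\Big(\frac{\sqrt{(x-a)(b-x)}}{(\sqrt{1-x}+\sqrt{1-a})(\sqrt{1-x}+\sqrt{1-b})}\Big)\mathbf{1}_{(a,b)}(x)$ if $\lambda\le\lambda_c$, and $\rho^{(c)}(x)=\frac{2}{\pi\lambda x}\arctan\Big(\sqrt{\frac{x-a}{b-x}}\frac{\sqrt{1-x}+\sqrt{1-b}}{\sqrt{1-x}+\sqrt{1-a}}\Big)\mathbf{1}_{(a,b)}(x)+\frac{1}{\lambda x}\mathbf{1}_{(b,1)}(x)$ if $\lambda>\lambda_c$. *)

(* Defs.v *)
From HB Require Import structures.
From mathcomp Require Import all_boot all_order all_algebra.
From mathcomp Require Import all_classical all_reals all_analysis.
Set Implicit Arguments. Unset Strict Implicit. Unset Printing Implicit Defensive.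
Import Order.TTheory GRing.Theory Num.Theory.
Import numFieldNormedType.Exports.
Local Open Scope classical_set_scope.
Local Open Scope ring_scope.

(* Pairs (p_n, p_{n+1}) of little q-Laguerre polynomials p_n(x; a | q). *)
Fixpoint lqL_pair {R : realType} (a q : R) (n : nat) : {poly R} * {poly R} :=
  match n with
  | 0 => (1, 1 - (1 - a * q)^-1 *: 'X)
  | m.+1 =>
      let pp := lqL_pair a q m in
      let m1 := m.+1 in
      let A := q ^+ m1 * (1 - a * q ^+ m1.+1) in
      let C := a * q ^+ m1 * (1 - q ^+ m1) in
      (pp.2, A^-1 *: ((A + C)%:P * pp.2 - 'X * pp.2 - C%:P * pp.1))
  end.

Definition little_qLaguerre {R : realType} (a q : R) (n : nat) : {poly R} :=
  (lqL_pair a q n).1.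

Definition zero_counting_integral {R : realType} (n : nat) (p : {poly R})
  (f : R -> R) : R :=
  n%:R^-1 * \sum_(x \in [set x : R | root p x]) ((mup x p)%:R * f x).

(* lambda_c : the unique positive l with e^{-l}(1 + e^{-c l}) = 1 *)
Definition lambda_crit {R : realType} (c : R) : R :=
  xget 0 [set l : R | 0 < l /\ expR (- l) * (1 + expR (- (c * l))) = 1].

Definition qMP_a {R : realType} (c lam : R) : R :=
  let s := expR (- lam) in
  (Num.sqrt (s * (1 - s `^ (c + 1))) - Num.sqrt (s `^ (c + 1) * (1 - s))) ^+ 2.

Definition qMP_b {R : realType} (c lam : R) : R :=
  let s := expR (- lam) in
  (Num.sqrt (s * (1 - s `^ (c + 1))) + Num.sqrt (s `^ (c + 1) * (1 - s))) ^+ 2.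

Definition qMP_density {R : realType} (c lam : R) (x : R) : R :=
  let a := qMP_a c lam in
  let b := qMP_b c lam in
  if lam <= lambda_crit c then
    (if (a < x) && (x < b) then
       2 / (pi * lam * x) *
       atan (Num.sqrt ((x - a) * (b - x)) /
             ((Num.sqrt (1 - x) + Num.sqrt (1 - a)) *
              (Num.sqrt (1 - x) + Num.sqrt (1 - b))))
     else 0)
  else
    (if (a < x) && (x < b) then
       2 / (pi * lam * x) *
       atan (Num.sqrt ((x - a) / (b - x)) *
             ((Num.sqrt (1 - x) + Num.sqrt (1 - b)) /
              (Num.sqrt (1 - x) + Num.sqrt (1 - a))))
     else 0)
    + (if (b < x) && (x < 1) then (lam * x)^-1 else 0).

(* Main.v *)
Require Import Defs.
From HB Require Import structures.
From mathcomp Require Import all_boot all_order all_algebra.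
From mathcomp Require Import all_classical all_reals all_analysis.
From mathcomp Require Import measurable_realfun polyrcf ring lra.
Set Implicit Arguments.
Unset Strict Implicit.
Unset Printing Implicit Defensive.
Import Order.TTheory GRing.Theory Num.Theory.
Import numFieldNormedType.Exports.
Local Open Scope classical_set_scope.
Local Open Scope ring_scope.

(* Interlacing puts the [n] zeros [x_j] of [p = p_n] in (0, 1), and [p] satisfies the
   q-difference equation [a p(qx) + (1 - x) p(x/q) = (a + 1 - x q^-n) p(x)].  At [x = -z]
   with [z > 0] both ratios [p(-z)/p(-qz)] and [p(-z/q)/p(-z)] are close to
   [E = exp (lam z G_n(z))], where [G_n] is the mean of [1/(x_j + z)].  With [g = e^(-lam c)]
   and [s = e^(-lam)] this gives [g/E + (1 + z) E -> 1 + g + z/s], whose left side is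
   strictly increasing on [E >= 1]; hence [G_n(z)] converges to [ln E / (lam z)].
   On (0, 1), away from its right edge [b], the density is [acos(Y)/(pi lam x)] with
   [Y = (1 + g - x/s) / (2 sqrt (g (1 - x)))] clipped to [-1, 1].  Writing both [acos Y] and
   [ln E] as integrals over [1 < v < 1/s] and exchanging the integrals over [x] and [v]
   identifies the limit of [G_n(z)] with the integral of [density / (x + z)].  Finally the
   functions [1/(x + z)] span a dense subspace of the continuous functions on [0, 1]. *)

(** * The q-difference equation *)

Section QPochhammer.
Context {R : comNzRingType}.
Implicit Types x q : R.

Definition qpoch x q (k : nat) : R := \prod_(i < k) (1 - x * q ^+ i).

Lemma qpoch0 x q : qpoch x q 0 = 1.
Proof. by rewrite /qpoch big_ord0. Qed.

Lemma qpochS x q k : qpoch x q k.+1 = qpoch x q k * (1 - x * q ^+ k).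
Proof. by rewrite /qpoch big_ord_recr. Qed.

Lemma qpochSl x q k : qpoch x q k.+1 = (1 - x) * qpoch (x * q) q k.
Proof.
rewrite /qpoch big_ord_recl expr0 mulr1; congr (_ * _).
by apply: eq_bigr => i _; rewrite exprS mulrA.
Qed.

End QPochhammer.

Section QPochhammerPositivity.
Context {R : numDomainType}.
Variable q : R.
Hypotheses (q_gt0 : 0 < q) (q_lt1 : q < 1).

Lemma onem_mulXn_gt0 (x : R) k : x < 1 -> 0 < 1 - x * q ^+ k.
Proof.
move=> x1; rewrite subr_gt0.
apply: (@lt_le_trans _ _ (q ^+ k)); first by rewrite gtr_pMl // exprn_gt0.
by rewrite exprn_ile1 // ltW.
Qed.

Lemma qpoch_gt0 (x : R) k : x < 1 -> 0 < qpoch x q k.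
Proof. by move=> x1; apply: prodr_gt0 => i _; exact: onem_mulXn_gt0. Qed.

End QPochhammerPositivity.

Section LittleQLaguerreSeries.
Context {R : realType}.
Implicit Types a q x : R.

Definition qLaguerre_coef a q (n k : nat) : R :=
  qpoch (q ^- n) q k * q ^+ k / (qpoch (a * q) q k * qpoch q q k).

Variables (a q : R).
Hypotheses (q_gt0 : 0 < q) (q_lt1 : q < 1) (aq_lt1 : a * q < 1).

Let q_neq0 : q != 0. Proof. exact: lt0r_neq0. Qed.

Let onem_aqX_neq0 k : 1 - a * q * q ^+ k != 0.
Proof. exact/lt0r_neq0/onem_mulXn_gt0. Qed.

Let onem_aXS_neq0 k : 1 - a * q ^+ k.+1 != 0.
Proof. by rewrite exprS mulrA. Qed.

Let onem_qX_neq0 k : 1 - q * q ^+ k != 0.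
Proof. exact/lt0r_neq0/onem_mulXn_gt0. Qed.

Let qpoch_aq_neq0 k : qpoch (a * q) q k != 0.
Proof. exact/lt0r_neq0/qpoch_gt0. Qed.

Let qpoch_q_neq0 k : qpoch q q k != 0.
Proof. exact/lt0r_neq0/qpoch_gt0. Qed.

Lemma qLaguerre_coef0 n : qLaguerre_coef a q n 0 = 1.
Proof. by rewrite /qLaguerre_coef !qpoch0 expr0 !mulr1 divr1. Qed.

Lemma qLaguerre_coef_gt n k : (n < k)%N -> qLaguerre_coef a q n k = 0.
Proof.
move=> nk; rewrite /qLaguerre_coef /qpoch (bigD1 (Ordinal nk)) //=.
by rewrite mulVf ?subrr ?mul0r // expf_neq0.
Qed.

Lemma qLaguerre_coefS n k :
  qLaguerre_coef a q n k.+1 * ((1 - a * q * q ^+ k) * (1 - q ^+ k.+1)) =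
  qLaguerre_coef a q n k * (q * (1 - q ^+ k / q ^+ n)).
Proof.
rewrite /qLaguerre_coef !qpochS !exprS.
move: (qpoch_aq_neq0 k) (qpoch_q_neq0 k) (onem_aqX_neq0 k) (onem_qX_neq0 k).
move: (q ^+ k) (q ^+ n) (expf_neq0 n q_neq0) (qpoch (q ^- n) q k)
  (qpoch (a * q) q k) (qpoch q q k) => Y X X0 P A Q A0 Q0 aY0 qY0.
by field; rewrite X0 A0 Q0 aY0 qY0.
Qed.

Lemma qLaguerre_coef_recurrence n k :
  let A := q ^+ n.+1 * (1 - a * q ^+ n.+2) in
  let C := a * q ^+ n.+1 * (1 - q ^+ n.+1) in
  A * qLaguerre_coef a q n.+2 k =
  (A + C) * qLaguerre_coef a q n.+1 k
  - (if k is k'.+1 then qLaguerre_coef a q n.+1 k' else 0)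
  - C * qLaguerre_coef a q n k.
Proof.
rewrite /=; set X := q ^+ n.+1.
have X0 : X != 0 by rewrite expf_neq0.
have XS : q ^+ n.+2 = q * X by rewrite exprS.
have Xn : q ^- n = X^-1 * q by rewrite /X exprS invfM mulrAC mulVf ?mul1r.
have XqV : (q * X)^-1 * q = X^-1 by rewrite invfM mulrAC mulVf ?mul1r.
rewrite /qLaguerre_coef XS Xn -/X.
case: k => [|[|k]].
- by rewrite !qpoch0; field.
- rewrite !qpochS !qpoch0 !expr0 expr1 !mulr1 !mul1r.
  have := onem_aqX_neq0 0; have := onem_qX_neq0 0; rewrite expr0 !mulr1 => q1 aq1.
  by field; rewrite X0 q_neq0 aq1 q1.
- rewrite !(qpochSl (q * X)^-1) XqV !(qpochSl X^-1) !qpochS !exprS.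
  move: (qpoch_aq_neq0 k) (qpoch_q_neq0 k) (onem_aqX_neq0 k) (onem_qX_neq0 k)
    (onem_aqX_neq0 k.+1) (onem_qX_neq0 k.+1); rewrite !exprS.
  move: (q ^+ k) (qpoch (X^-1 * q) q k) (qpoch (a * q) q k) (qpoch q q k).
  move=> Y P A Q A0 Q0 aY0 qY0 aqY0 qqY0.
  by field; rewrite X0 q_neq0 A0 Q0 aY0 qY0 aqY0 qqY0.
Qed.

Lemma little_qLaguerre_recurrence n :
  let A := q ^+ n.+1 * (1 - a * q ^+ n.+2) in
  let C := a * q ^+ n.+1 * (1 - q ^+ n.+1) in
  little_qLaguerre a q n.+2 = A^-1 *: ((A + C)%:P * little_qLaguerre a q n.+1
    - 'X * little_qLaguerre a q n.+1 - C%:P * little_qLaguerre a q n).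
Proof. by []. Qed.

Lemma coef_little_qLaguerre n k :
  (little_qLaguerre a q n)`_k = qLaguerre_coef a q n k.
Proof.
suff : (forall k, (little_qLaguerre a q n)`_k = qLaguerre_coef a q n k) /\
    (forall k, (little_qLaguerre a q n.+1)`_k = qLaguerre_coef a q n.+1 k).
  by case.
elim: n {k} => [|n [IH0 IH1]]; split => k //.
- rewrite /little_qLaguerre /= coef1; case: k => [|k].
    by rewrite qLaguerre_coef0.
  by rewrite qLaguerre_coef_gt.
- rewrite /little_qLaguerre /= coefB coef1 coefZ coefX.
  case: k => [|[|k]]; last by rewrite qLaguerre_coef_gt //= mulr0 subr0.
    by rewrite qLaguerre_coef0 mulr0 subr0.
  rewrite /qLaguerre_coef !qpochS !qpoch0 !expr0 !expr1 !mulr1 !mul1r sub0r.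
  have := onem_aqX_neq0 0; have := onem_qX_neq0 0; rewrite expr0 !mulr1 => q1 aq1.
  by field; rewrite q_neq0 aq1 q1.
- rewrite little_qLaguerre_recurrence.
  have := qLaguerre_coef_recurrence n k => /=.
  set A := (q ^+ n.+1 * _); set C := (a * _ * _).
  have A0 : A != 0 by rewrite mulf_neq0 ?expf_neq0.
  rewrite coefZ !coefB !coefCM coefXM IH0 IH1 => E.
  apply: (mulfI A0); rewrite E mulrA mulfV // mul1r; congr (_ - _ - _).
  by case: k {E} => [|k] //=; rewrite IH1.
Qed.

Lemma size_little_qLaguerre n : (size (little_qLaguerre a q n) <= n.+1)%N.
Proof.
by apply/leq_sizeP => j nj; rewrite coef_little_qLaguerre qLaguerre_coef_gt.
Qed.

Lemma little_qLaguerre_at0 n : (little_qLaguerre a q n).[0] = 1.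
Proof. by rewrite horner_coef0 coef_little_qLaguerre qLaguerre_coef0. Qed.

Lemma little_qLaguerre_qdifference n x :
  let p := little_qLaguerre a q n in
  a * p.[q * x] + (1 - x) * p.[x / q] = (a + 1 - x / q ^+ n) * p.[x].
Proof.
rewrite /=; set p := little_qLaguerre a q n.
have pE y : p.[y] = \sum_(k < n.+1) qLaguerre_coef a q n k * y ^+ k.
  rewrite (horner_coef_wide _ (size_little_qLaguerre n)).
  by apply: eq_bigr => k _; rewrite coef_little_qLaguerre.
(* The difference of the two sides is the telescoping sum of F k - F (k + 1). *)
pose F k := qLaguerre_coef a q n k * x ^+ k *
  ((1 - q ^+ k) * (1 - a * q ^+ k) / q ^+ k).
have FS k : F k.+1 = qLaguerre_coef a q n k * (q * (1 - q ^+ k / q ^+ n)) *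
    (x ^+ k.+1 / q ^+ k.+1).
  by rewrite -qLaguerre_coefS /F (exprS q); ring.
have F0 : F 0%N = 0 by rewrite /F expr0 subrr !mul0r mulr0.
have Fn : F n.+1 = 0 by rewrite /F qLaguerre_coef_gt ?mul0r.
apply/eqP; rewrite -subr_eq0 !pE !mulr_sumr -big_split -sumrB /=.
rewrite (eq_bigr (fun k : 'I_n.+1 => - (F k.+1 - F k))) => [|k _].
  rewrite sumrN -(big_mkord xpredT (fun k => F k.+1 - F k)).
  by rewrite telescope_sumr // F0 Fn subrr oppr0.
rewrite FS /F !exprMn exprVn !exprS.
have := expf_neq0 k q_neq0; have := expf_neq0 n q_neq0.
move: (q ^+ n) (q ^+ k) (x ^+ k) (qLaguerre_coef _ _ _ _) => X Y Z W X0 Y0.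
by field; rewrite X0 Y0 q_neq0.
Qed.

Hypothesis a_gt0 : 0 < a.

Lemma little_qLaguerre_at1S n : (little_qLaguerre a q n.+1).[1] =
  - (a * q ^+ n.+1 / (1 - a * q ^+ n.+1)) * (little_qLaguerre a q n).[1].
Proof.
have a0 := lt0r_neq0 a_gt0.
elim: n => [|n IH].
  rewrite /little_qLaguerre /= !hornerE expr1; have := onem_aXS_neq0 0.
  by rewrite expr1 => aq1; field.
have X0 : q ^+ n.+1 != 0 by rewrite expf_neq0.
have prevE : (little_qLaguerre a q n).[1] =
    - ((1 - a * q ^+ n.+1) / (a * q ^+ n.+1)) * (little_qLaguerre a q n.+1).[1].
  by rewrite IH; move: (onem_aXS_neq0 n) X0 => aX X0; field; rewrite aX X0 a0.
rewrite little_qLaguerre_recurrence !(exprS q n.+1).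
move: (onem_aqX_neq0 n.+1) X0 prevE; move: (q ^+ n.+1) => X aqX X0 prevE.
rewrite hornerZ !hornerE prevE.
by field; rewrite X0 aqX a0.
Qed.

Lemma little_qLaguerre_at1_sign n : 0 < (-1) ^+ n * (little_qLaguerre a q n).[1].
Proof.
elim: n => [|n IH]; first by rewrite /little_qLaguerre /= !hornerE ltr01.
rewrite little_qLaguerre_at1S exprS mulN1r [X in _ * X]mulNr mulrNN mulrCA.
rewrite mulr_gt0 // divr_gt0 ?mulr_gt0 ?exprn_gt0 // exprS mulrA.
exact: onem_mulXn_gt0.
Qed.

End LittleQLaguerreSeries.

(** * Zeros *)

Section ProdOnem.
Context {F : fieldType}.
Implicit Types (p : {poly F}) (s : seq F) (x : F).

Definition prod_onem s : {poly F} := \prod_(r <- s) (1 - r^-1 *: 'X).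

Lemma horner_prod_onem s x : (prod_onem s).[x] = \prod_(r <- s) (1 - x / r).
Proof.
by rewrite /prod_onem horner_prod; apply: eq_bigr => r _; rewrite !hornerE mulrC.
Qed.

Lemma horner_prod_onemN s x :
  (prod_onem s).[- x] = \prod_(r <- s) (1 + x / r).
Proof.
by rewrite horner_prod_onem; apply: eq_bigr => r _; rewrite mulNr opprK.
Qed.

Lemma size_prod_onem s : (size (prod_onem s) <= (size s).+1)%N.
Proof.
rewrite /prod_onem; elim: s => [|r s IH]; first by rewrite big_nil size_poly1.
rewrite big_cons; apply: leq_trans (size_polyMleq _ _) _ => /=.
have size_factor : (size (1 - r^-1 *: 'X : {poly F})%R <= 2)%N.
  apply: leq_trans (size_polyD _ _) _; rewrite size_polyN geq_max size_poly1 /=.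
  by apply: leq_trans (size_scale_leq _ _) _; rewrite size_polyX.
by rewrite -subn1 leq_subLR add1n; exact: leq_add size_factor IH.
Qed.

Lemma root_prod_onem s x : 0 \notin s -> root (prod_onem s) x = (x \in s).
Proof.
move=> s0; rewrite rootE horner_prod_onem prodf_seq_eq0.
apply/hasP/idP => [[r rs /=]|xs].
  have r0 : r != 0 by apply: contraNneq s0 => <-.
  by rewrite subr_eq0 eq_sym => /eqP xr; rewrite -(divfK r0 x) xr mul1r.
by exists x => //=; rewrite divff ?subrr //; apply: contraNneq s0 => <-.
Qed.

Lemma poly_eq_prod_onem p s : (size p <= (size s).+1)%N -> uniq s ->
  0 \notin s -> all (root p) s -> p.[0] = 1 -> p = prod_onem s.
Proof.
move=> sz us s0 rs p0; apply/eqP; rewrite -subr_eq0; apply/negPn/negP => D0.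
have /(max_poly_roots D0) : all (root (p - prod_onem s)) (0 :: s).
  apply/allP => x; rewrite inE rootE hornerD hornerN => /orP[/eqP ->|xs].
    rewrite p0 horner_prod_onem big1 ?subrr // => r _.
    by rewrite mul0r subr0.
  have /rootP -> : root (prod_onem s) x by rewrite root_prod_onem.
  by rewrite (rootP (allP rs _ xs)) subrr.
rewrite /= s0 us => /(_ isT); apply/negP; rewrite -leqNgt.
apply: leq_trans (size_polyD _ _) _.
by rewrite size_polyN geq_max sz size_prod_onem.
Qed.

Lemma mup_prod_onem s x : 0 \notin s -> mup x (prod_onem s) = count_mem x s.
Proof.
move=> s0.
have prodE : prod_onem s =
    (\prod_(r <- s) - r^-1)%:P * \prod_(r <- s) ('X - r%:P).
  rewrite rmorph_prod -big_split /= /prod_onem !big_seq; apply: eq_bigr => r rs.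
  rewrite polyCN mulrBr mulNr mul_polyC mulNr opprK -polyCM mulVf ?polyC1.
    by rewrite addrC.
  by apply: contraNneq s0 => <-.
rewrite prodE mupMr ?mu_prod_XsubC // rootC prodf_seq_neq0; apply/allP => r rs /=.
by rewrite oppr_eq0 invr_eq0; apply: contraNneq s0 => <-.
Qed.

End ProdOnem.

Definition seq_mean {R : realType} (s : seq R) (f : R -> R) : R :=
  (size s)%:R^-1 * \sum_(x <- s) f x.

Lemma zero_counting_integral_prod_onem {R : realType} (s : seq R) f :
  uniq s -> 0 \notin s ->
  zero_counting_integral (size s) (prod_onem s) f = seq_mean s f.
Proof.
move=> us s0; rewrite /zero_counting_integral; congr (_ * _).
have -> : [set x | root (prod_onem s) x] = [set` s].
  by apply/seteqP; split => x /=; rewrite root_prod_onem.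
rewrite -fsbig_seq // !big_seq; apply: eq_bigr => x xs.
by rewrite mup_prod_onem // count_uniq_mem // xs mul1r.
Qed.

Section InterlacingZeros.
Context {R : rcfType}.
Implicit Types (p r : {poly R}) (y t : nat -> R).

Lemma poly_alternating_roots p m t :
  (forall i, (i <= m)%N -> t i < t i.+1) ->
  (forall i, (i <= m.+1)%N -> 0 < (-1) ^+ i * p.[t i]) ->
  exists y, forall i, (i <= m)%N -> t i < y i < t i.+1 /\ root p (y i).
Proof.
move=> tlt tsgn.
suff /choice[y yP] : forall i, exists x, (i <= m)%N ->
    t i < x < t i.+1 /\ root p x by exists y.
move=> i; case: (leqP i m) => im; last by exists 0.
have sign_change : p.[t i] * p.[t i.+1] < 0.
  have := mulr_gt0 (tsgn i (leqW im)) (tsgn i.+1 im).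
  by rewrite exprS mulN1r mulNr mulrN oppr_gt0 mulrACA -expr2 sqrr_sign mul1r.
have [x + rx] := poly_ivtoo (ltW (tlt i im)) sign_change.
by rewrite in_itv /= => xt; exists x.
Qed.

Definition zeros_in01 n p y :=
  [/\ forall i, (i < n)%N -> 0 < y i < 1,
      forall i j, (i < j < n)%N -> y i < y j &
      forall i, (i < n)%N -> root p (y i)].

Lemma zeros_in01_prod_onem n p y : zeros_in01 n p y -> (size p <= n.+1)%N ->
  p.[0] = 1 -> uniq (mkseq y n) /\ p = prod_onem (mkseq y n).
Proof.
move=> [y01 ylt yroot] sz p0.
have uy : uniq (mkseq y n).
  apply/mkseq_uniqP => i j; rewrite !inE => iln jln yij.
  case: (ltngtP i j) => // ij; [have := ylt i j|have := ylt j i].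
    by rewrite yij ij jln ltxx => /(_ isT).
  by rewrite yij ij iln ltxx => /(_ isT).
split => //; apply: poly_eq_prod_onem => //; first by rewrite size_mkseq.
- apply/mapP => -[i]; rewrite mem_iota => /y01/andP[+ _] => /[swap] <-.
  by rewrite ltxx.
- by apply/allP => _ /mapP[i + ->]; rewrite mem_iota => /yroot.
Qed.

Definition nodes01 n y (i : nat) : R :=
  if i is j.+1 then (if (j < n)%N then y j else 1) else 0.

Lemma nodes01_lt n p y i : zeros_in01 n p y -> (i <= n)%N ->
  nodes01 n y i < nodes01 n y i.+1.
Proof.
move=> [y01 ylt _]; case: i => [|i] /= iln.
  by case: ifPn => [/y01/andP[]//|_]; exact: ltr01.
rewrite iln; case: ifPn => [iSn|_]; first by rewrite ylt // ltnSn.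
by case/andP: (y01 i iln).
Qed.

Lemma nodes01_le n p y i j : zeros_in01 n p y -> (i <= j <= n.+1)%N ->
  nodes01 n y i <= nodes01 n y j.
Proof.
move=> yP /andP[]; elim: j => [|j IH]; first by rewrite leqn0 => /eqP ->.
rewrite leq_eqVlt => /orP[/eqP -> //|ij jn].
by apply: le_trans (IH _ _) (ltW (nodes01_lt yP _)) => //; exact: ltnW.
Qed.

Lemma zeros_in01_interlacing n p r y : zeros_in01 n p y ->
  (forall i, (i <= n.+1)%N -> 0 < (-1) ^+ i * r.[nodes01 n y i]) ->
  exists2 z, zeros_in01 n.+1 r z &
    forall i, (i <= n)%N -> nodes01 n y i < z i < nodes01 n y i.+1.
Proof.
move=> yP /(poly_alternating_roots (fun i => nodes01_lt yP))[z zP].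
exists z; last by move=> i iln; have [] := zP i iln.
split=> [i iln|i j /andP[ij jn]|i iln]; last by have [] := zP i iln.
- have [/andP[yz zy] _] := zP i iln; apply/andP; split.
    by apply: le_lt_trans yz; apply: (nodes01_le (i := 0) yP); exact: leqW.
  apply: lt_le_trans zy _.
  have := @nodes01_le n p y i.+1 n.+1 yP; rewrite /= ltnn; apply.
  by rewrite leqnn andbT.
- have [/andP[_ zy] _] := zP i (leq_trans (ltnW ij) jn).
  have [/andP[yz _] _] := zP j jn.
  apply: lt_trans zy (le_lt_trans (nodes01_le yP _) yz).
  by rewrite ij leqW.
Qed.

Lemma prod_onem_nodes01_sign n p y x i : zeros_in01 n p y -> (i <= n)%N ->
  nodes01 n y i < x < nodes01 n y i.+1 ->
  0 < (-1) ^+ i * (prod_onem (mkseq y n)).[x].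
Proof.
move=> yP iln /andP[yx xy]; have [y01 _ _] := yP.
have y0 j : (j < n)%N -> 0 < y j by move=> /y01/andP[].
rewrite horner_prod_onem big_map -[n in iota 0 n]subn0.
rewrite (big_cat_nat (n := i)) //= mulrA mulr_gt0 //.
  have -> : (-1) ^+ i * \prod_(0 <= j < i) (1 - x / y j) =
      \prod_(0 <= j < i) - (1 - x / y j).
    by rewrite !big_mkord prodrN card_ord.
  rewrite big_mkord; apply: prodr_gt0 => -[j ji] _ /=.
  have jn := leq_trans ji iln.
  rewrite oppr_gt0 subr_lt0 ltr_pdivlMr ?mul1r ?y0 //.
  apply: le_lt_trans yx; have := @nodes01_le n p y j.+1 i yP.
  by rewrite /= jn ji leqW //; exact.
rewrite big_nat; apply: prodr_gt0 => j /andP[ij jn].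
rewrite subr_gt0 ltr_pdivrMr ?mul1r ?y0 //.
apply: lt_le_trans xy _; have := @nodes01_le n p y i.+1 j.+1 yP.
by rewrite [nodes01 n y j.+1]/= jn !ltnS ij; apply; exact: ltnW.
Qed.

End InterlacingZeros.

Section LittleQLaguerreZeros.
Context {R : realType}.
Variables (a q : R).
Hypotheses (q_gt0 : 0 < q) (q_lt1 : q < 1) (a_gt0 : 0 < a) (aq_lt1 : a * q < 1).
Local Notation P := (little_qLaguerre a q).

Lemma little_qLaguerre_nodes01_sign n y : zeros_in01 n (P n) y ->
  (forall i, (i < n)%N -> 0 < (-1) ^+ i * (P n.-1).[y i]) ->
  forall i, (i <= n.+1)%N -> 0 < (-1) ^+ i * (P n.+1).[nodes01 n y i].
Proof.
move=> [_ _ yroot] ysgn [_|i] /=.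
  by rewrite little_qLaguerre_at0 // mulr1 ltr01.
case: ifPn => [iln _|]; last first.
  rewrite -leqNgt ltnS => ni iln.
  have -> : i = n by apply/eqP; rewrite eqn_leq ni iln.
  exact: little_qLaguerre_at1_sign.
have := ysgn _ iln; have := yroot _ iln.
case: n iln {yroot ysgn} => // n iln /rootP yi0 /=.
rewrite little_qLaguerre_recurrence hornerZ.
rewrite !(hornerD, hornerN, hornerM, hornerC) yi0 !mulr0 subr0 sub0r.
set A := (q ^+ _ * _); set C := (a * _ * _) => sgn.
have -> : (-1) ^+ i.+1 * (A^-1 * - (C * (P n).[y i])) =
  C / A * ((-1) ^+ i * (P n).[y i]) by rewrite exprS; ring.
have C0 : 0 < C.
  by rewrite /C exprS !mulr_gt0 ?exprn_gt0 // onem_mulXn_gt0.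
have A0 : 0 < A.
  by rewrite /A [in 1 - _]exprS mulrA mulr_gt0 ?exprn_gt0 // onem_mulXn_gt0.
by rewrite mulr_gt0 // divr_gt0.
Qed.

Lemma little_qLaguerre_interlacing n : exists2 y, zeros_in01 n (P n) y &
  forall i, (i < n)%N -> 0 < (-1) ^+ i * (P n.-1).[y i].
Proof.
elim: n => [|n [y yP ysgn]].
  by exists (fun=> 0) => //; split => // i j; rewrite ltn0 andbF.
have [z zP zy] :=
  zeros_in01_interlacing yP (little_qLaguerre_nodes01_sign yP ysgn).
exists z => //= i iln; have := prod_onem_nodes01_sign yP iln (zy i iln).
by have [_ <-] := zeros_in01_prod_onem yP (size_little_qLaguerre q_gt0 q_lt1
  aq_lt1 n) (little_qLaguerre_at0 q_gt0 q_lt1 aq_lt1 n).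
Qed.

Lemma little_qLaguerre_zeros n : exists s : seq R,
  [/\ size s = n, uniq s, {in s, forall x, 0 < x < 1} & P n = prod_onem s].
Proof.
have [y yP _] := little_qLaguerre_interlacing n; have [y01 _ _] := yP.
have [uy PE] := zeros_in01_prod_onem yP (size_little_qLaguerre q_gt0 q_lt1
  aq_lt1 n) (little_qLaguerre_at0 q_gt0 q_lt1 aq_lt1 n).
exists (mkseq y n); split => //; first exact: size_mkseq.
by move=> _ /mapP[i + ->]; rewrite mem_iota => /y01.
Qed.

End LittleQLaguerreZeros.

(** * Limit of the Stieltjes sums *)

Section StieltjesSums.
Context {R : realType}.
Implicit Types (s : seq R) (y z : R).

Definition stieltjes_sum s z := \sum_(x <- s) (x + z)^-1.

Lemma prod_le_expR s (F G T : R -> R) :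
  {in s, forall x, 0 <= F x <= expR (T x) * G x} ->
  \prod_(x <- s) F x <= expR (\sum_(x <- s) T x) * \prod_(x <- s) G x.
Proof. by move=> FG; rewrite expR_sum -big_split /= !big_seq; exact: ler_prod. Qed.

Variable s : seq R.
Hypothesis s_gt0 : {in s, forall x, 0 < x}.

Let addS_gt0 x y : x \in s -> 0 < y -> 0 < x + y.
Proof. by move=> /s_gt0 x0 y0; exact: addr_gt0. Qed.

Let factor_ge0 x y : x \in s -> 0 < y -> 0 <= 1 + y / x.
Proof. by move=> /s_gt0 x0 y0; rewrite addr_ge0 // divr_ge0 // ltW. Qed.

Lemma stieltjes_sum_ge0 z : 0 < z -> 0 <= stieltjes_sum s z.
Proof.
move=> z0; rewrite /stieltjes_sum big_seq sumr_ge0 // => x xs.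
by rewrite invr_ge0 ltW // addS_gt0.
Qed.

Lemma stieltjes_sum_le z : 0 < z -> z * stieltjes_sum s z <= (size s)%:R.
Proof.
move=> z0; have -> : (size s)%:R = \sum_(x <- s) (1 : R).
  by rewrite big_const_seq count_predT iter_addr_0.
rewrite mulr_sumr !big_seq; apply: ler_sum => x xs.
by rewrite ler_pdivrMr ?addS_gt0 // mul1r lerDr; exact/ltW/s_gt0.
Qed.

Lemma stieltjes_sum_scale q z : 0 < q -> q <= 1 -> 0 < z ->
  stieltjes_sum s (q * z) <= stieltjes_sum s z / q.
Proof.
move=> q0 q1 z0; rewrite /stieltjes_sum mulr_suml !big_seq.
apply: ler_sum => x xs; rewrite -invfM lef_pV2 ?posrE.
- by rewrite mulrDl [z * q]mulrC lerD2r ler_piMr //; exact/ltW/s_gt0.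
- by rewrite addS_gt0 // mulr_gt0.
- by rewrite mulr_gt0 // addS_gt0.
Qed.

Lemma prod_onem_ratio_bounds y y' : 0 < y -> y <= y' ->
  expR ((y' - y) * stieltjes_sum s y') * (prod_onem s).[- y]
    <= (prod_onem s).[- y']
    <= expR ((y' - y) * stieltjes_sum s y) * (prod_onem s).[- y].
Proof.
move=> y0 yy'; have y'0 : 0 < y' by exact: lt_le_trans yy'.
rewrite !horner_prod_onemN; apply/andP; split.
  rewrite -ler_pdivlMl ?expR_gt0 // -expRN -mulNr mulr_sumr.
  apply: prod_le_expR => x xs; rewrite factor_ge0 //=.
  have -> : 1 + y / x = (1 + - (y' - y) * (x + y')^-1) * (1 + y' / x).
    by field; rewrite !lt0r_neq0 ?addS_gt0 // s_gt0.
  by rewrite ler_wpM2r ?expR_ge1Dx ?factor_ge0.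
rewrite mulr_sumr; apply: prod_le_expR => x xs; rewrite factor_ge0 //=.
have -> : 1 + y' / x = (1 + (y' - y) * (x + y)^-1) * (1 + y / x).
  by field; rewrite !lt0r_neq0 ?addS_gt0 // s_gt0.
by rewrite ler_wpM2r ?expR_ge1Dx ?factor_ge0.
Qed.

Lemma prod_onem_gt0 y : 0 < y -> 0 < (prod_onem s).[- y].
Proof.
move=> y0; rewrite horner_prod_onemN big_seq; apply: prodr_gt0 => x /s_gt0 x0.
by rewrite addr_gt0 // divr_gt0.
Qed.

Lemma prod_onem_mulq_bounds q z : 0 < q -> q < 1 -> 0 < z ->
  let t := (1 - q) * z * stieltjes_sum s z in
  expR (- (t / q)) * (prod_onem s).[- z] <= (prod_onem s).[- (q * z)]
    <= expR (- t) * (prod_onem s).[- z].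
Proof.
move=> q0 q1 z0; set t := _ * _ => /=.
rewrite !expRN ler_pdivrMl ?ler_pdivlMl ?expR_gt0 //.
have qz0 : 0 < q * z by rewrite mulr_gt0.
have qzz : q * z <= z by rewrite ler_piMl // ltW.
have /andP[lo hi] := prod_onem_ratio_bounds qz0 qzz.
have tE : (z - q * z) * stieltjes_sum s z = t by rewrite /t; ring.
rewrite tE in lo; rewrite lo andbT; apply: le_trans hi _.
rewrite ler_wpM2r ?ler_expR ?(ltW (prod_onem_gt0 _)) // -tE -mulrA.
by rewrite ler_wpM2l ?subr_ge0 // stieltjes_sum_scale // ltW.
Qed.

Lemma prod_onem_divq_bounds q z : 0 < q -> q < 1 -> 0 < z ->
  let t := (1 - q) * z * stieltjes_sum s z in
  expR t * (prod_onem s).[- z] <= (prod_onem s).[- (z / q)]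
    <= expR (t / q) * (prod_onem s).[- z].
Proof.
move=> q0 q1 z0; set t := _ * _ => /=; have q_neq0 := lt0r_neq0 q0.
have zq0 : 0 < z / q by rewrite divr_gt0.
have zzq : z <= z / q by rewrite ler_pdivlMr // ler_piMr // ltW.
have /andP[lo hi] := prod_onem_ratio_bounds z0 zzq.
have tE : (z / q - z) * stieltjes_sum s z = t / q by rewrite /t; field.
rewrite tE in hi; rewrite hi andbT; apply: le_trans lo.
rewrite ler_wpM2r ?ler_expR ?(ltW (prod_onem_gt0 _)) //.
have -> : t = (z / q - z) * (q * stieltjes_sum s z) by rewrite /t; field.
rewrite ler_wpM2l ?subr_ge0 // -ler_pdivlMl // mulrC.
by have := stieltjes_sum_scale q0 (ltW q1) zq0; rewrite mulrCA mulfV ?mulr1.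
Qed.

End StieltjesSums.

Section ResolventMap.
Context {R : realType}.
Implicit Types a g q t u z : R.

Definition resolvent_map g z t := g * expR (- t) + (1 + z) * expR t.

Lemma expR_sub_ge t u : 0 <= t -> t <= u -> u - t <= expR u - expR t.
Proof.
move=> t0 tu.
have -> : expR u - expR t = expR t * (expR (u - t) - 1).
  by rewrite mulrBr -expRD mulr1 [t + _]addrC subrK.
apply: le_trans (_ : expR (u - t) - 1 <= _); first by rewrite lerBrDl expR_ge1Dx.
by rewrite ler_peMl ?subr_ge0 -?expR0 ?ler_expR ?subr_ge0.
Qed.

Lemma expRN_sub_le t u : 0 <= t -> t <= u ->
  expR (- t) - expR (- u) <= expR u - expR t.
Proof.
move=> t0 tu; have u0 := le_trans t0 tu.
have -> : expR (- t) - expR (- u) = (expR u - expR t) * (expR (- t) * expR (- u)).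
  by rewrite !expRN; field; rewrite !lt0r_neq0 ?expR_gt0.
rewrite ler_piMr ?subr_ge0 ?ler_expR //.
by rewrite mulr_ile1 ?expR_ge0 // expR_le1 oppr_le0.
Qed.

Lemma resolvent_map_expansive g z t u : 0 <= g -> g <= 1 -> 0 <= z ->
  0 <= t -> 0 <= u ->
  z * `|t - u| <= `|resolvent_map g z t - resolvent_map g z u|.
Proof.
move=> g0 g1 z0; wlog tu : t u / u <= t => [hw t0 u0|t0 u0].
  have [ut|/ltW tu] := leP u t; first exact: hw.
  by rewrite (distrC t) [leRHS]distrC; exact: hw.
rewrite ger0_norm ?subr_ge0 //; apply: le_trans (ler_norm _).
have diff_pos : 0 <= expR t - expR u by rewrite subr_ge0 ler_expR.
have g_part := le_trans (ler_wpM2l g0 (expRN_sub_le u0 tu)) (ler_piMl diff_pos g1).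
have z_part := ler_wpM2l z0 (expR_sub_ge u0 tu).
rewrite /resolvent_map; move: g_part z_part; lra.
Qed.

Lemma resolvent_map_dist_coef g a z t : 0 <= t ->
  `|resolvent_map g z t - resolvent_map a z t| <= `|g - a|.
Proof.
move=> t0; rewrite /resolvent_map opprD addrACA subrr addr0 -mulrBl normrM.
by rewrite ler_piMr // ger0_norm ?expR_ge0 // expR_le1 oppr_le0.
Qed.

(* The q-difference equation at [-z], with the ratios of consecutive values
   squeezed between exponentials of the Stieltjes sum. *)
Lemma little_qLaguerre_resolvent_map_dist a q z n s :
  0 < q -> q < 1 -> 0 < a -> a * q < 1 -> 0 < z ->
  {in s, forall x, 0 < x} -> little_qLaguerre a q n = prod_onem s ->
  let t := (1 - q) * z * stieltjes_sum s z in
  `|resolvent_map a z t - (a + 1 + z / q ^+ n)|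
    <= (a + 1 + z) * (expR (t / q) - expR t).
Proof.
move=> q0 q1 a0 aq1 z0 s0 PE; set t := _ * _ => /=.
have t0 : 0 <= t.
  by rewrite !mulr_ge0 ?stieltjes_sum_ge0 // ?subr_ge0 ltW.
have ttq : t <= t / q by rewrite ler_pdivlMr // ler_piMr // ltW.
have Pz := prod_onem_gt0 s0 z0.
have := little_qLaguerre_qdifference q0 q1 aq1 n (- z); rewrite /= PE.
rewrite mulrN !mulNr !opprK => qdiff.
have /andP[mulq_ge mulq_le] := prod_onem_mulq_bounds s0 q0 q1 z0.
have /andP[divq_ge divq_le] := prod_onem_divq_bounds s0 q0 q1 z0.
rewrite -/t in mulq_ge mulq_le divq_ge divq_le.
have expRN_le := expRN_sub_le t0 ttq.
set width := (expR (t / q) - expR t) * (prod_onem s).[- z].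
have /andP[mulq_gap_ge0 mulq_gap_le] : 0 <= a * (expR (- t) * (prod_onem s).[- z] -
    (prod_onem s).[- (q * z)]) <= a * width.
  rewrite mulr_ge0 ?subr_ge0 ?(ltW a0) //= ler_wpM2l ?(ltW a0) //.
  rewrite lerBlDr -lerBlDl; apply: le_trans mulq_ge; rewrite /width -mulrBl.
  by rewrite ler_wpM2r ?(ltW Pz) // lerBlDr -lerBlDl.
have z1 : 0 <= 1 + z by rewrite addr_ge0 // ltW.
have /andP[divq_gap_ge0 divq_gap_le] : 0 <= (1 + z) * ((prod_onem s).[- (z / q)] -
    expR t * (prod_onem s).[- z]) <= (1 + z) * width.
  by rewrite mulr_ge0 ?subr_ge0 //= ler_wpM2l // /width mulrBl lerB.
rewrite -(ler_pM2r Pz) -[X in _ * X <= _](gtr0_norm Pz) -normrM mulrBl -qdiff.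
rewrite -[leRHS]mulrA -/width /resolvent_map ler_norml.
apply/andP; split; move: mulq_gap_ge0 mulq_gap_le divq_gap_ge0 divq_gap_le; lra.
Qed.

End ResolventMap.

Lemma cvg_expR {R : realType} (u : nat -> R) (l : R) : u k @[k --> \oo] --> l ->
  expR (u k) @[k --> \oo] --> expR l.
Proof. by apply: continuous_cvg; exact: continuous_expR. Qed.

Section ResolventRoot.
Context {R : realType}.
Implicit Types g z v x : R.

(* The discriminant of [(1 - x) E^2 - (1 + g - x v) E + g] in [E]. *)
Definition qMP_discr g x v := (1 + g - x * v) ^+ 2 - 4 * g * (1 - x).

Definition resolvent_root g z v :=
  (1 + g + z * v + Num.sqrt (qMP_discr g (- z) v)) / (2 * (1 + z)).

Lemma qMP_discrN g z v :
  qMP_discr g (- z) v = (1 + g + z * v) ^+ 2 - 4 * g * (1 + z).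
Proof. by rewrite /qMP_discr mulNr !opprK. Qed.

Lemma qMP_discrN_ge g z v : 0 <= g -> 0 <= z -> 1 <= v ->
  (1 + z - g) ^+ 2 <= qMP_discr g (- z) v.
Proof.
move=> g0 z0 v1; rewrite qMP_discrN.
have zv : z <= z * v by rewrite ler_peMr.
have : (1 + g + z) ^+ 2 <= (1 + g + z * v) ^+ 2 by rewrite lerXn2r // ?nnegrE; lra.
lra.
Qed.

Variables (g z v : R).
Hypotheses (g_ge0 : 0 <= g) (g_le1 : g <= 1) (z_gt0 : 0 < z) (v_ge1 : 1 <= v).
Local Notation E := (resolvent_root g z v).

Lemma qMP_discrN_gt0 : 0 < qMP_discr g (- z) v.
Proof.
apply: lt_le_trans (qMP_discrN_ge g_ge0 (ltW z_gt0) v_ge1).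
by rewrite exprn_gt0 //; move: g_le1 z_gt0; lra.
Qed.

Lemma resolvent_root_ge1 : 1 <= E.
Proof.
have := ler_wsqrtr (qMP_discrN_ge g_ge0 (ltW z_gt0) v_ge1).
rewrite sqrtr_sqr => /(le_trans (ler_norm _)) sqrt_ge.
have zv : z <= z * v by rewrite ler_peMr // ltW.
rewrite /resolvent_root ler_pdivlMr; move: sqrt_ge zv z_gt0; lra.
Qed.

Lemma resolvent_root_quadratic :
  (1 + z) * E ^+ 2 + g = (1 + g + z * v) * E.
Proof.
have := sqr_sqrtr (ltW qMP_discrN_gt0).
rewrite /resolvent_root; set S := Num.sqrt _ => S2.
have z1 : 1 + z != 0 by rewrite lt0r_neq0 // addr_gt0.
have -> : (1 + z) * ((1 + g + z * v + S) / (2 * (1 + z))) ^+ 2 =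
    ((1 + g + z * v) ^+ 2 + 2 * (1 + g + z * v) * S + S ^+ 2) / (4 * (1 + z)).
  by field.
by rewrite S2 qMP_discrN; field.
Qed.

Lemma resolvent_map_ln_root : resolvent_map g z (ln E) = 1 + g + z * v.
Proof.
have E0 : 0 < E := lt_le_trans ltr01 resolvent_root_ge1.
have E_neq0 := lt0r_neq0 E0.
rewrite /resolvent_map expRN lnK ?posrE //; apply: (mulIf E_neq0).
by rewrite -resolvent_root_quadratic; field.
Qed.

End ResolventRoot.

Section ResolventLimit.
Context {R : realType}.

Lemma expR_divq_sub_le (q t M : R) : 0 < q -> q <= 1 -> 0 <= t -> t <= M ->
  expR (t / q) - expR t <= expR M * (expR (M * (q^-1 - 1)) - 1).
Proof.
move=> q0 q1 t0 tM; have d0 : 0 <= q^-1 - 1 by rewrite subr_ge0 invf_ge1.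
have -> : expR (t / q) - expR t = expR t * (expR (t * (q^-1 - 1)) - 1).
  by rewrite !mulrBr !mulr1 -expRD [t + _]addrC subrK.
apply: ler_pM; rewrite ?expR_ge0 ?ler_expR //.
  by rewrite subr_ge0 -[leLHS]expR0 ler_expR mulr_ge0.
by rewrite lerB // ler_expR ler_wpM2r.
Qed.

Variables (a q : nat -> R) (n : nat -> nat) (r : nat -> seq R) (g lam s z : R).
Hypotheses (q01 : forall k, 0 < q k < 1)
  (a_gt0 : forall k, 0 < a k) (aq_lt1 : forall k, a k * q k < 1).
Hypotheses (size_r : forall k, size (r k) = n k)
  (r01 : forall k, {in r k, forall x, 0 < x < 1})
  (rP : forall k, little_qLaguerre (a k) (q k) (n k) = prod_onem (r k)).
Hypotheses (g_ge0 : 0 <= g) (g_le1 : g <= 1) (s_gt0 : 0 < s) (s_le1 : s <= 1)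
  (z_gt0 : 0 < z).
Hypotheses (cvg_a : a k @[k --> \oo] --> g) (cvg_q : q k @[k --> \oo] --> (1 : R))
  (cvg_qn : q k ^+ n k @[k --> \oo] --> s)
  (cvg_n : (1 - q k) * (n k)%:R @[k --> \oo] --> lam).
Let t k := (1 - q k) * z * stieltjes_sum (r k) z.
Let tau := ln (resolvent_root g z s^-1).
Let M k := (1 - q k) * (n k)%:R.
Let dist_bound k := `|g - a k| +
  (a k + 1 + z) * (expR (M k) * (expR (M k * ((q k)^-1 - 1)) - 1)) +
  `|(a k + 1 + z / q k ^+ n k) - (1 + g + z * s^-1)|.

Let r_gt0 k : {in r k, forall x, 0 < x}.
Proof. by move=> x /r01/andP[]. Qed.

Lemma scaled_stieltjes_sum_dist k : z * `|t k - tau| <= dist_bound k.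
Proof.
have /andP[q0 q1] := q01 k.
have v1 : 1 <= s^-1 by rewrite invf_ge1.
have tau0 : 0 <= tau by rewrite ln_ge0 // resolvent_root_ge1.
have t0 : 0 <= t k.
  by rewrite !mulr_ge0 ?stieltjes_sum_ge0 // ?subr_ge0 ltW.
have tM : t k <= M k.
  by rewrite /t -mulrA ler_wpM2l ?subr_ge0 ?(ltW q1) // -size_r stieltjes_sum_le.
apply: le_trans (resolvent_map_expansive g_ge0 g_le1 (ltW z_gt0) t0 tau0) _.
rewrite resolvent_map_ln_root //.
apply: le_trans (ler_distD (resolvent_map (a k) z (t k)) _ _) _.
rewrite /dist_bound -[leRHS]addrA lerD ?resolvent_map_dist_coef //.
apply: le_trans (ler_distD (a k + 1 + z / q k ^+ n k) _ _) _.
rewrite lerD2r; apply: le_trans (little_qLaguerre_resolvent_map_dist q0 q1 (a_gt0 k)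
  (aq_lt1 k) z_gt0 (@r_gt0 k) (rP k)) _.
by rewrite ler_wpM2l ?expR_divq_sub_le ?addr_ge0 // ltW.
Qed.

Lemma cvg_dist_bound : dist_bound k @[k --> \oo] --> (0 : R).
Proof.
have cvg_qV : (q k)^-1 - 1 @[k --> \oo] --> (0 : R).
  rewrite -(subrr (1 : R)); apply: cvgB; last exact: cvg_cst.
  by rewrite -[X in _ --> X]invr1; apply: cvgV => //; exact: oner_neq0.
rewrite (_ : 0 = `|g - g| + (g + 1 + z) * (expR lam * (expR (lam * 0) - 1)) +
  `|(g + 1 + z / s) - (1 + g + z * s^-1)|); last first.
  by rewrite mulr0 expR0 !subrr !mulr0 [g + 1]addrC subrr !normr0 !addr0.
have cvg_a1 : a k + 1 @[k --> \oo] --> g + 1 by apply: cvgD => //; exact: cvg_cst.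
apply: cvgD; first apply: cvgD.
- by apply: cvg_norm; apply: cvgB => //; exact: cvg_cst.
- apply: cvgM; first by apply: cvgD => //; exact: cvg_cst.
  apply: cvgM; first exact: cvg_expR.
  by apply: cvgB; [apply: cvg_expR; exact: cvgM|exact: cvg_cst].
- apply: cvg_norm; apply: cvgB; last exact: cvg_cst.
  apply: cvgD => //; apply: cvgMl_tmp; apply: cvgV => //; exact: lt0r_neq0.
Qed.

Lemma cvg_scaled_stieltjes_sum : t k @[k --> \oo] --> tau.
Proof.
apply/subr_cvg0/norm_cvg0P.
apply: (@squeeze_cvgr _ _ _ _ (fun=> 0) (fun k => z^-1 * dist_bound k)).
- by apply: nearW => k; rewrite normr_ge0 ler_pdivlMl // scaled_stieltjes_sum_dist.
- exact: cvg_cst.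
- by rewrite -(mulr0 z^-1); apply: cvgMl_tmp; exact: cvg_dist_bound.
Qed.

Lemma cvg_seq_mean_resolvent : 0 < lam ->
  seq_mean (r k) (fun x => (x + z)^-1) @[k --> \oo] -->
  ln (resolvent_root g z s^-1) / (lam * z).
Proof.
move=> lam0; have z_neq0 := lt0r_neq0 z_gt0.
apply: (@cvg_trans _ (t k / (M k * z) @[k --> \oo])); last first.
  apply: cvgM; first exact: cvg_scaled_stieltjes_sum.
  by apply: cvgV; [rewrite mulf_neq0 ?lt0r_neq0|exact: cvgMr_tmp].
apply: near_eq_cvg; near=> k; have /andP[q0 q1] := q01 k.
have M0 : 0 < M k by near: k; exact: cvgr_gt cvg_n _ lam0.
have : (n k)%:R != 0 :> R by apply: contraTneq M0; rewrite /M => ->; rewrite mulr0 ltxx.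
move=> n0; rewrite /seq_mean size_r -/(stieltjes_sum _ _) /t /M; field.
by rewrite z_neq0 n0 subr_eq0 gt_eqF.
Unshelve. all: by end_near. Qed.

End ResolventLimit.

(** * The density as an angle *)

Section AcosClip.
Context {R : realType}.
Implicit Types y T : R.

Definition clip y : R := Num.max (-1) (Num.min 1 y).

Definition acos_clip y : R := acos (clip y).

Lemma clip_itv y : -1 <= clip y <= 1.
Proof. by rewrite /clip le_max lexx /= ge_max ge_min lexx /= andbT; lra. Qed.

Lemma acos_clip_id y : -1 < y < 1 -> acos_clip y = acos y.
Proof. by move=> /andP[y1 y2]; rewrite /acos_clip /clip min_r ?max_r // ltW. Qed.

Lemma acos_clip_ge1 y : 1 <= y -> acos_clip y = 0.
Proof. by move=> y1; rewrite /acos_clip /clip min_l // max_r ?acos1 //; lra. Qed.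

Lemma acos_clip_leN1 y : y <= -1 -> acos_clip y = pi.
Proof.
by move=> y1; rewrite /acos_clip /clip min_r ?max_l ?acosN1 // (le_trans y1); lra.
Qed.

Lemma continuous_acos_clip : continuous acos_clip.
Proof.
have cont_acos : {within `[(-1), 1], continuous (@acos R)}.
  have := @segment_can_ge_continuous R 0 pi cos acos (pi_ge0 R).
  rewrite cospi cos0; apply; last exact: cosK.
  by apply: continuous_subspaceT; exact: continuous_cos.
have cont_clip : continuous clip.
  move=> y; apply: (@continuous_max _ _ (fun=> -1) (fun y => Num.min 1 y)).
    exact: cst_continuous.
  apply: (@continuous_min _ _ (fun=> 1) id); first exact: cst_continuous.
  exact: cvg_id.
have clip_seg y : `[(-1), 1]%classic (clip y) by rewrite /= in_itv /= clip_itv.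
move=> y; apply/cvgrPdist_lt => e e0.
have /subspace_continuousP/(_ _ (clip_seg y))/cvgrPdist_lt/(_ _ e0) := cont_acos.
rewrite near_withinE => /cont_clip near_acos; near=> x.
by have := clip_seg x; near: x.
Unshelve. all: by end_near. Qed.

Lemma acos_half_angle y T : 0 <= T -> -1 < y < 1 -> T ^+ 2 * (1 + y) = 1 - y ->
  acos y = 2 * atan T.
Proof.
move=> T0 /andP[y1 y2] T2.
have -> : y = cos (2 * atan T).
  rewrite mulr_natl cos_mulr2n cos_atan exprVn sqr_sqrtr ?addr_ge0 ?sqr_ge0 //.
  have -> : T ^+ 2 = (1 - y) / (1 + y) by rewrite -T2; field; lra.
  by rewrite mulr2n; field; lra.
rewrite cosK // in_itv /=; have := atan_ltpi2 T.
have : 0 <= atan T by rewrite -(atan0 R) le_atan.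
lra.
Qed.

End AcosClip.

Section TriangleAngle.
Context {R : realType}.
Implicit Types w m l : R.

(* The angle between the sides [w] and [m] of a triangle with third side [l]. *)
Definition triangle_cos w m l : R := (w ^+ 2 + m ^+ 2 - l ^+ 2) / (2 * m * w).

Definition triangle_angle w m l : R := acos_clip (triangle_cos w m l).

Variables (w m l : R).
Hypotheses (w_gt0 : 0 < w) (m_gt0 : 0 < m) (l_gt0 : 0 < l).

Lemma triangle_angle_eq0 : (w <= m - l) || (m + l <= w) -> triangle_angle w m l = 0.
Proof.
move=> flat; apply: acos_clip_ge1; rewrite ler_pdivlMr ?mulr_gt0 //.
have : l ^+ 2 <= (w - m) ^+ 2; last by lra.
rewrite -(real_normK (num_real (w - m))) lerXn2r ?nnegrE ?(ltW l_gt0) //.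
by rewrite ler_normr orbC; case/orP: flat => flat; apply/orP; [left|right]; lra.
Qed.

Lemma triangle_angle_eqpi : w <= l - m -> triangle_angle w m l = pi.
Proof.
move=> flat; apply: acos_clip_leN1; rewrite ler_pdivrMr ?mulr_gt0 //.
have : (w + m) ^+ 2 <= l ^+ 2; last by lra.
rewrite lerXn2r ?nnegrE ?addr_ge0 ?(ltW w_gt0) ?(ltW m_gt0) ?(ltW l_gt0) //; lra.
Qed.

Lemma triangle_cos_itv : w < m + l -> m - l < w -> l - m < w ->
  -1 < triangle_cos w m l < 1.
Proof.
move=> wml mlw lmw; rewrite ltr_pdivlMr ?ltr_pdivrMr ?mulr_gt0 //.
have : l ^+ 2 < (w + m) ^+ 2.
  by rewrite ltrXn2r ?nnegrE ?addr_ge0 ?(ltW w_gt0) ?(ltW m_gt0) ?(ltW l_gt0) //; lra.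
have : (w - m) ^+ 2 < l ^+ 2.
  rewrite -(real_normK (num_real (w - m))) ltrXn2r ?nnegrE ?(ltW l_gt0) //.
  by rewrite ltr_norml; lra.
lra.
Qed.

Lemma triangle_angle_sub : l <= m -> triangle_angle w m l =
  if (w < m + l) && (m - l < w) then
    2 * atan (Num.sqrt (((m + l) ^+ 2 - w ^+ 2) * (w ^+ 2 - (m - l) ^+ 2)) /
      ((w + (m + l)) * (w + (m - l))))
  else 0.
Proof.
move=> lm; case: ifPn => [/andP[wml mlw]|]; last first.
  by rewrite negb_and -!leNgt orbC => /triangle_angle_eq0.
have lmw : l - m < w by move: lm w_gt0; lra.
have cos_itv := triangle_cos_itv wml mlw lmw.
rewrite /triangle_angle acos_clip_id //; apply: acos_half_angle => //.
  rewrite divr_ge0 ?sqrtr_ge0 // mulr_ge0 //; move: w_gt0 m_gt0 l_gt0 lm; lra.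
have wml0 : 0 < (m + l - w) * (w + (m + l)).
  by rewrite mulr_gt0 //; move: w_gt0 m_gt0 l_gt0; lra.
have mlw0 : 0 < (w - (m - l)) * (w + (m - l)).
  by rewrite mulr_gt0 //; move: w_gt0 m_gt0 l_gt0 lm; lra.
rewrite expr_div_n sqr_sqrtr; last by rewrite mulr_ge0 //; lra.
rewrite /triangle_cos; field.
by rewrite !lt0r_neq0 //; move: w_gt0 m_gt0 l_gt0 lm; lra.
Qed.

Lemma triangle_angle_sup : m < l -> w != l - m -> triangle_angle w m l =
  (if (w < m + l) && (l - m < w) then
    2 * atan (Num.sqrt (((m + l) ^+ 2 - w ^+ 2) / (w ^+ 2 - (l - m) ^+ 2)) *
      ((w + (l - m)) / (w + (m + l))))
  else 0) + (if w < l - m then pi else 0).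
Proof.
move=> ml; rewrite neq_lt => /orP[wlm|lmw].
  rewrite wlm [_ < w]ltNge (ltW wlm) andbF add0r.
  exact/triangle_angle_eqpi/ltW.
rewrite lmw [w < l - m]ltNge (ltW lmw) andbT addr0; case: ltP => wml; last first.
  by rewrite triangle_angle_eq0 // wml orbT.
have mlw : m - l < w by move: ml w_gt0; lra.
have cos_itv := triangle_cos_itv wml mlw lmw.
rewrite /triangle_angle acos_clip_id //; apply: acos_half_angle => //.
  by rewrite mulr_ge0 ?sqrtr_ge0 // divr_ge0 //; move: w_gt0 m_gt0 l_gt0 ml; lra.
have wml0 : 0 < (m + l - w) * (w + (m + l)).
  by rewrite mulr_gt0 //; move: w_gt0 m_gt0 l_gt0; lra.
have lmw0 : 0 < (w - (l - m)) * (w + (l - m)).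
  by rewrite mulr_gt0 //; move: w_gt0 m_gt0 l_gt0 ml; lra.
rewrite exprMn sqr_sqrtr; last by rewrite divr_ge0 //; lra.
rewrite /triangle_cos; field.
by rewrite !lt0r_neq0 //; move: w_gt0 m_gt0 l_gt0 ml lmw0; lra.
Qed.

End TriangleAngle.

Section CriticalLambda.
Context {R : realType}.
Implicit Types c lam : R.

Definition lambda_crit_fun c lam : R := expR (- lam) * (1 + expR (- (c * lam))).

Lemma lambda_crit_fun_decr c : 0 <= c ->
  {homo lambda_crit_fun c : l l' / l < l' >-> l' < l}.
Proof.
move=> c0 l l' ll'; rewrite /lambda_crit_fun.
apply: (@lt_le_trans _ _ (expR (- l) * (1 + expR (- (c * l'))))).
  by rewrite ltr_pM2r ?ltr_expR ?ltrN2 // ltr_pwDl // expR_ge0.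
by rewrite ler_pM2l ?expR_gt0 // lerD2l ler_expR lerN2 ler_wpM2l // ltW.
Qed.

Lemma lambda_crit_fun_continuous c : continuous (lambda_crit_fun c).
Proof.
move=> x; apply: cvgM.
  apply: continuous_comp; last exact: continuous_expR.
  exact: opp_continuous.
apply: cvgD; first exact: cvg_cst.
apply: continuous_comp; last exact: continuous_expR.
by apply: cvgN; apply: cvgMl_tmp.
Qed.

Lemma lambda_crit_fun_eq1 c : 0 <= c -> exists2 l, 0 < l & lambda_crit_fun c l = 1.
Proof.
move=> c0; have fun0 : lambda_crit_fun c 0 = 2.
  by rewrite /lambda_crit_fun mulr0 oppr0 expR0 mul1r.
have fun1 : lambda_crit_fun c 1 <= 1.
  rewrite /lambda_crit_fun mulr1 expRN mulrC ler_pdivrMr ?expR_gt0 // mul1r.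
  by apply: le_trans (expR_ge1Dx 1); rewrite lerD2l expR_le1 oppr_le0.
have cont : {within `[0, 1], continuous (lambda_crit_fun c)}.
  by apply: continuous_subspaceT; exact: lambda_crit_fun_continuous.
have [|l] := @IVT R (lambda_crit_fun c) 0 1 1 ler01 cont.
  by rewrite fun0 ge_min fun1 orbT le_max ler1n.
rewrite in_itv /= => /andP[l0 _] funl; exists l => //.
by rewrite lt_neqAle l0 andbT; apply: contra_eqN funl => /eqP <-; rewrite fun0; lra.
Qed.

Lemma le_lambda_crit c lam : 0 <= c ->
  (lam <= lambda_crit c) = (1 <= lambda_crit_fun c lam).
Proof.
move=> c0; rewrite /lambda_crit; case: xgetP => [m _ [_ mE]|noroot].
  rewrite -mE -/(lambda_crit_fun c m); apply/idP/idP => [|le_fun].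
    by rewrite le_eqVlt => /orP[/eqP -> //|/(lambda_crit_fun_decr c0)/ltW].
  rewrite leNgt; apply/negP => /(lambda_crit_fun_decr c0).
  by rewrite ltNge le_fun.
by have [l l0 lE] := lambda_crit_fun_eq1 c0; case: (noroot l).
Qed.

End CriticalLambda.

Section DensityAngle.
Context {R : realType}.
Implicit Types g v x u : R.

Definition qMP_cos g v x : R := (1 + g - x * v) / (2 * Num.sqrt (g * (1 - x))).

Definition qMP_angle g v x : R := acos_clip (qMP_cos g v x).

Lemma sqrt_onem_lt x u : x < 1 -> 0 <= u -> (Num.sqrt (1 - x) < u) = (1 - u ^+ 2 < x).
Proof.
move=> x1 u0; rewrite -[LHS](@ltr_pXn2r _ 2) ?nnegrE ?sqrtr_ge0 //.
by rewrite sqr_sqrtr ?subr_ge0 ?(ltW x1) // ltrBlDr -ltrBlDl.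
Qed.

Lemma lt_sqrt_onem x u : x < 1 -> 0 <= u -> (u < Num.sqrt (1 - x)) = (x < 1 - u ^+ 2).
Proof.
move=> x1 u0; rewrite -[LHS](@ltr_pXn2r _ 2) ?nnegrE ?sqrtr_ge0 //.
by rewrite sqr_sqrtr ?subr_ge0 ?(ltW x1) // ltrBrDr -ltrBrDl.
Qed.

Variables (c lam : R).
Hypotheses (c_ge0 : 0 <= c) (lam_gt0 : 0 < lam).
Let s := expR (- lam).
Let g := expR (- (lam * c)).
Let m := s * Num.sqrt g.
Let l := Num.sqrt ((1 - s) * (1 - s * g)).

Let s_gt0 : 0 < s. Proof. exact: expR_gt0. Qed.
Let g_gt0 : 0 < g. Proof. exact: expR_gt0. Qed.
Let s_lt1 : s < 1. Proof. by rewrite expR_lt1 oppr_lt0. Qed.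

Let sg_lt1 : s * g < 1.
Proof.
apply: le_lt_trans s_lt1; rewrite ler_piMr ?(ltW s_gt0) //.
by rewrite expR_le1 oppr_le0 mulr_ge0 // ltW.
Qed.

Let m_gt0 : 0 < m. Proof. by rewrite mulr_gt0 // sqrtr_gt0. Qed.
Let l_gt0 : 0 < l. Proof. by rewrite sqrtr_gt0 mulr_gt0 // subr_gt0. Qed.
Let m2 : m ^+ 2 = s ^+ 2 * g. Proof. by rewrite exprMn sqr_sqrtr // ltW. Qed.

Let l2 : l ^+ 2 = (1 - s) * (1 - s * g).
Proof. by rewrite sqr_sqrtr // ltW // mulr_gt0 // subr_gt0. Qed.

Lemma qMP_abE : qMP_a c lam = 1 - (m + l) ^+ 2 /\ qMP_b c lam = 1 - (m - l) ^+ 2.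
Proof.
have sc : s `^ (c + 1) = s * g by rewrite -expRM -expRD; congr expR; ring.
have u0 : 0 < s * (1 - s * g) by rewrite mulr_gt0 // subr_gt0.
have v0 : 0 < s * g * (1 - s) by rewrite !mulr_gt0 // subr_gt0.
have ml : Num.sqrt (s * (1 - s * g)) * Num.sqrt (s * g * (1 - s)) = m * l.
  have ml2 : s * (1 - s * g) * (s * g * (1 - s)) = (m * l) ^+ 2.
    by rewrite exprMn m2 l2; ring.
  by rewrite -sqrtrM ?(ltW u0) // ml2 sqrtr_sqr gtr0_norm // mulr_gt0.
rewrite /qMP_a /qMP_b -/s sc !sqrrB !sqrrD m2 l2 ml.
by rewrite !sqr_sqrtr ?(ltW u0) ?(ltW v0) //; split; ring.
Qed.

Lemma qMP_cosE x : x < 1 ->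
  qMP_cos g (expR lam) x = triangle_cos (Num.sqrt (1 - x)) m l.
Proof.
move=> x1; have x1' : 0 < 1 - x by rewrite subr_gt0.
rewrite /qMP_cos /triangle_cos sqr_sqrtr ?(ltW x1') // m2 l2 /m.
have -> : expR lam = s^-1 by rewrite /s expRN invrK.
rewrite sqrtrM ?(ltW g_gt0) //.
have := lt0r_neq0 s_gt0; have : Num.sqrt g != 0 by rewrite lt0r_neq0 ?sqrtr_gt0.
have : Num.sqrt (1 - x) != 0 by rewrite lt0r_neq0 ?sqrtr_gt0.
by move=> w0 h0 s0; field; rewrite w0 h0 s0.
Qed.

Lemma le_lambda_crit_sides : (lam <= lambda_crit c) = (l <= m).
Proof.
rewrite le_lambda_crit // /lambda_crit_fun [c * lam]mulrC -/s -/g.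
rewrite -[RHS](@ler_pXn2r _ 2) ?nnegrE ?(ltW l_gt0) ?(ltW m_gt0) // m2 l2.
by apply/idP/idP; lra.
Qed.

Lemma qMP_densityE x : 0 < x -> x < 1 -> x != qMP_b c lam ->
  qMP_density c lam x = qMP_angle g (expR lam) x / (pi * lam * x).
Proof.
move=> x0 x1; rewrite /qMP_density /qMP_angle qMP_cosE // le_lambda_crit_sides.
have [-> ->] := qMP_abE; set w := Num.sqrt (1 - x).
have w0 : 0 < w by rewrite sqrtr_gt0 subr_gt0.
have xE : x = 1 - w ^+ 2 by rewrite sqr_sqrtr ?subr_ge0 ?(ltW x1) //; ring.
have -> : 1 - (1 - (m + l) ^+ 2) = (m + l) ^+ 2 by ring.
have -> : 1 - (1 - (m - l) ^+ 2) = (m - l) ^+ 2 by ring.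
have -> : x - (1 - (m + l) ^+ 2) = (m + l) ^+ 2 - w ^+ 2 by rewrite xE; ring.
have -> : 1 - (m - l) ^+ 2 - x = w ^+ 2 - (m - l) ^+ 2 by rewrite xE; ring.
have ml0 : 0 <= m + l by rewrite addr_ge0 // ltW.
rewrite -(sqrt_onem_lt x1 ml0) -/w !sqrtr_sqr (ger0_norm ml0).
have x_neq0 := lt0r_neq0 x0; have lam_neq0 := lt0r_neq0 lam_gt0.
have pi_neq0 := lt0r_neq0 (pi_gt0 R).
have [lm _|ml xb] := leP l m.
  have ml_ge0 : 0 <= m - l by rewrite subr_ge0.
  rewrite -(lt_sqrt_onem x1 ml_ge0) -/w ger0_norm // -/(triangle_angle w m l).
  rewrite triangle_angle_sub //; case: ifP => _; last by rewrite mul0r.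
  by move: (pi : R) pi_neq0 => P P0; field; rewrite x_neq0 lam_neq0 P0.
have lm_gt0 : 0 < l - m by rewrite subr_gt0.
have lm2 : (m - l) ^+ 2 = (l - m) ^+ 2 by ring.
have w_neq : w != l - m.
  by apply: contraNneq xb => wE; rewrite {1}xE wE lm2.
rewrite lm2 -(lt_sqrt_onem x1 (ltW lm_gt0)) -(sqrt_onem_lt x1 (ltW lm_gt0)) -/w.
rewrite distrC (gtr0_norm lm_gt0) x1 andbT -/(triangle_angle w m l).
rewrite triangle_angle_sup // [RHS]mulrDl.
move: (pi : R) pi_neq0 => P P0.
by congr (_ + _); case: ifP => _; rewrite ?mul0r //; field; rewrite x_neq0 lam_neq0 P0.
Qed.

End DensityAngle.

(** * Integrals of arccosine type *)

Lemma integral_subset_support d (T : measurableType d) (R : realType)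
    (mu : {measure set T -> \bar R}) (A B : set T) (h : T -> \bar R) :
  B `<=` A -> (forall x, A x -> ~ B x -> h x = 0%E) ->
  (\int[mu]_(x in A) h x = \int[mu]_(x in B) h x)%E.
Proof.
move=> BA h0; rewrite integral_mkcond [RHS]integral_mkcond.
apply: eq_integral => x _; rewrite !patchE.
case: ifPn => [/set_mem xA|xA]; case: ifPn => [/set_mem xB|xB] //.
  by rewrite h0 //; move: xB; rewrite notin_setE.
by move: xA; rewrite notin_setE; case; exact: BA.
Qed.

Section OpenIntervalFTC.
Context {R : realType}.
Local Notation mu := (@lebesgue_measure R).
Implicit Types (a b x : R) (f F : R -> R).

Lemma is_derive_continuous F x (dF : R) :
  is_derive x (1 : R) F dF -> {for x, continuous F}.
Proof.
move=> h; apply: differentiable_continuous; apply/derivable1_diffP.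
exact: ex_derive.
Qed.

Lemma continuous_FTC2_inner f F a b a' b' : a < a' -> a' < b' -> b' < b ->
  {in `]a, b[, continuous f} ->
  {in `]a, b[, forall x, is_derive x (1 : R) F (f x)} ->
  (\int[mu]_(x in `[a', b']) (f x)%:E = (F b' - F a')%:E)%E.
Proof.
move=> aa' ab' bb' cf dF.
have inner x : x \in `[a', b'] -> x \in `]a, b[.
  rewrite !in_itv /= => /andP[a'x xb'].
  by rewrite (lt_le_trans aa') // (le_lt_trans xb').
have inner_oo x : x \in `]a', b'[ -> x \in `]a, b[ by move=> /subset_itv_oo_cc/inner.
rewrite EFinB (@continuous_FTC2 R f F) //.
- by apply: continuous_in_subspaceT => x; rewrite inE => /inner; exact: cf.
- split => [x /inner_oo/dF dFx| |]; first exact: ex_derive.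
    apply: cvg_at_right_filter; apply: is_derive_continuous (dF a' _).
    by apply: inner; rewrite in_itv /= lexx ltW.
  apply: cvg_at_left_filter; apply: is_derive_continuous (dF b' _).
  by apply: inner; rewrite in_itv /= lexx ltW.
- by move=> x /inner_oo/dF dFx; rewrite derive1E derive_val.
Qed.

Lemma itvoo_bigcup_cc a b (e : nat -> R) : (forall n, 0 < e n) ->
  e n @[n --> \oo] --> (0 : R) ->
  \bigcup_n `[a + e n, b - e n]%classic = `]a, b[%classic.
Proof.
move=> e0 cvg_e; apply/seteqP; split => x.
  by move=> [n _]; rewrite /= !in_itv /= => /andP[]; have := e0 n; lra.
rewrite /= in_itv /= => /andP[ax xb].
have : 0 < Num.min (x - a) (b - x) by rewrite lt_min !subr_gt0 ax.
move/cvgr_lt : cvg_e => /[apply] -[n _ /(_ n (leqnn n))].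
rewrite lt_min => /andP[ex exb]; exists n => //.
by rewrite /= in_itv /=; lra.
Qed.

Lemma ge0_continuous_FTC2_oo f F a b : a < b ->
  {in `]a, b[, forall x, 0 <= f x} -> {in `]a, b[, continuous f} ->
  {in `]a, b[, forall x, is_derive x (1 : R) F (f x)} ->
  {within `[a, b], continuous F} ->
  (\int[mu]_(x in `]a, b[) (f x)%:E = (F b - F a)%:E)%E.
Proof.
move=> ab f0 cf dF /(continuous_within_itvP _ ab)[_ Fa Fb].
have ba0 : 0 < (b - a) / 3 by rewrite divr_gt0 // subr_gt0.
pose e (n : nat) : R := (b - a) / 3 * n.+1%:R^-1.
have e0 n : 0 < e n by rewrite mulr_gt0 // invr_gt0.
have e3 n : e n <= (b - a) / 3 by rewrite ler_piMr ?(ltW ba0) // invf_le1 // ler1n.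
have e_decr m n : (m <= n)%N -> e n <= e m.
  by move=> mn; rewrite ler_pM2l // lef_pV2 ?posrE // ler_nat ltnS.
have cvg_e : e n @[n --> \oo] --> (0 : R).
  by rewrite -(mulr0 ((b - a) / 3)); apply: cvgMl_tmp; exact: cvg_harmonic.
pose A n : set R := `[a + e n, b - e n]%classic.
have bigcupA : \bigcup_n A n = `]a, b[%classic := itvoo_bigcup_cc a b e0 cvg_e.
have subA n : A n `<=` `]a, b[%classic by rewrite -bigcupA => x Ax; exists n.
have mf : measurable_fun `]a, b[ (fun x => (f x)%:E).
  apply/measurable_EFinP; apply: open_continuous_measurable_fun => // x.
  by rewrite inE => /cf.
have cvg_integral : (\int[mu]_(x in A n) (f x)%:E)%E @[n --> \oo] -->
    (\int[mu]_(x in `]a, b[) (f x)%:E)%E.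
  rewrite -bigcupA; apply: ge0_nondecreasing_set_cvg_integral => //.
  - move=> m n mn; apply/subsetPset => x; rewrite /A /= !in_itv /= => /andP[].
    by have := e_decr _ _ mn; lra.
  - by move=> n; exact: measurable_itv.
  - by move=> n; exact: measurable_funS mf.
  - by move=> n x /subA xab; rewrite lee_fin f0.
have FTC n : (\int[mu]_(x in A n) (f x)%:E = (F (b - e n) - F (a + e n))%:E)%E.
  by apply: continuous_FTC2_inner cf dF; have := e3 n; have := e0 n; lra.
have : (\int[mu]_(x in A n) (f x)%:E)%E @[n --> \oo] --> (F b - F a)%:E.
  under eq_fun do rewrite FTC.
  apply: cvg_EFin; first exact: nearW.
  apply: cvgB.
    apply: (cvg_at_leftP _ _ _).1 Fb _ _; split => [n|]; first by rewrite ltrBlDr ltrDl.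
    by rewrite -[X in _ --> X]subr0; apply: cvgB => //; exact: cvg_cst.
  apply: (cvg_at_rightP _ _ _).1 Fa _ _; split => [n|]; first by rewrite ltrDl.
  by rewrite -[X in _ --> X]addr0; apply: cvgD => //; exact: cvg_cst.
by move/cvg_lim => <- //; apply/esym/cvg_lim.
Qed.

End OpenIntervalFTC.

Section AcosIntegral.
Context {R : realType}.
Local Notation mu := (@lebesgue_measure R).

Lemma antitone_level_point (phi : R -> R) (a b y : R) : a <= b ->
  {within `[a, b], continuous phi} ->
  {in `[a, b] &, {homo phi : u v /~ u < v}} ->
  exists c, [/\ a <= c <= b, forall x, a <= x < c -> y < phi x,
    forall x, c < x <= b -> phi x < y, a < c -> y <= phi c & c < b -> phi c <= y].
Proof.
move=> ab cphi decr.
have decrE u v : a <= u -> u < v -> v <= b -> phi v < phi u.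
  move=> au uv vb; have uv' := ltW uv.
  by apply: decr => //; rewrite in_itv /= ?au ?vb ?(le_trans uv' vb) ?(le_trans au uv').
have [ya|ay] := leP (phi a) y.
  exists a; rewrite lexx ab ltxx; split => // x; first by lra.
  by move=> /andP[ax xb]; apply: lt_le_trans (decrE _ _ _ ax xb) ya.
have [yb|yb] := leP y (phi b).
  exists b; rewrite lexx ab ltxx; split => // x; last by lra.
  by move=> /andP[ax xb]; apply: le_lt_trans yb (decrE _ _ ax xb _).
have [|c] := IVT ab cphi (v := y).
  by rewrite ge_min le_max (ltW yb) (ltW ay) orbT.
rewrite in_itv /= => /andP[ac cb] phic; exists c; rewrite ac cb -phic lexx.
by split => // x /andP[? ?]; exact: decrE.
Qed.

Lemma antitone_acos_clip_window (phi : R -> R) (a b : R) : a <= b ->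
  {within `[a, b], continuous phi} ->
  {in `[a, b] &, {homo phi : u v /~ u < v}} ->
  exists c1 c2, [/\ a <= c1, c1 <= c2 & c2 <= b] /\
    [/\ forall x, c1 < x < c2 -> -1 < phi x < 1,
      forall x, a < x < b -> ~~ (c1 < x < c2) -> 1 <= phi x ^+ 2,
      acos_clip (phi a) = acos_clip (phi c1) &
      acos_clip (phi b) = acos_clip (phi c2)].
Proof.
move=> ab cphi decr.
have [c1 [/andP[ac1 c1b] gt1 lt1 c1_ge1 _]] := antitone_level_point 1 ab cphi decr.
have [c2 [/andP[ac2 c2b] gtN1 ltN1 _ c2_leN1]] :=
  antitone_level_point (-1) ab cphi decr.
have c12 : c1 <= c2.
  rewrite leNgt; apply/negP => c21; pose x := (c1 + c2) / 2.
  have /gt1 phi_gt1 : a <= x < c1 by rewrite /x; lra.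
  have /ltN1 phi_ltN1 : c2 < x <= b by rewrite /x; lra.
  lra.
have ge1 x : a < c1 -> a <= x <= c1 -> 1 <= phi x.
  move=> ac /andP[ax]; rewrite le_eqVlt => /orP[/eqP ->|xc]; first exact: c1_ge1.
  by apply/ltW/gt1; rewrite ax.
have leN1 x : c2 < b -> c2 <= x <= b -> phi x <= -1.
  move=> cb /andP[+ xb]; rewrite le_eqVlt => /orP[/eqP <-|cx]; first exact: c2_leN1.
  by apply/ltW/ltN1; rewrite cx.
exists c1, c2; split => //; split.
- move=> x /andP[c1x xc2]; rewrite gtN1 ?lt1 //.
    by rewrite c1x (le_trans (ltW xc2)).
  by rewrite xc2 (le_trans ac1) // ltW.
- move=> x /andP[ax xb]; rewrite negb_and -!leNgt => /orP[xc1|c2x].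
    have phi_ge1 : 1 <= phi x by rewrite ge1 ?(lt_le_trans ax) // ltW.
    by rewrite expr2 mulr_ege1.
  have phi_leN1 : phi x <= -1 by rewrite leN1 ?(le_lt_trans c2x) // c2x ltW.
  by rewrite -sqrrN expr2 mulr_ege1 // lerNr.
- move: ac1; rewrite le_eqVlt => /orP[/eqP -> //|ac1].
  by rewrite !acos_clip_ge1 // ge1 ?lexx ?(ltW ac1).
- move: c2b; rewrite le_eqVlt => /orP[/eqP -> //|c2b].
  by rewrite !acos_clip_leN1 // leN1 ?lexx ?(ltW c2b).
Qed.

Lemma integral_acos_comp (phi dphi : R -> R) (a b k : R) : a < b -> 0 <= k ->
  {in `]a, b[, forall x, -1 < phi x < 1} ->
  {in `]a, b[, forall x, dphi x <= 0} -> {in `]a, b[, continuous dphi} ->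
  {in `]a, b[, forall x, is_derive x (1 : R) phi (dphi x)} ->
  {within `[a, b], continuous phi} ->
  (\int[mu]_(x in `]a, b[) (k * (- dphi x / Num.sqrt (1 - phi x ^+ 2)))%:E =
    (k * (acos_clip (phi b) - acos_clip (phi a)))%:E)%E.
Proof.
move=> ab k0 phi1 dphi0 cdphi dphiP cphi; rewrite mulrBr.
have sqrt_gt0 x : x \in `]a, b[ -> 0 < Num.sqrt (1 - phi x ^+ 2).
  move=> /phi1; rewrite -ltr_norml => phi_lt1.
  by rewrite sqrtr_gt0 subr_gt0 -real_normK ?num_real // expr_lt1.
apply: (@ge0_continuous_FTC2_oo _ _ (fun x => k * acos_clip (phi x))) => //.
- by move=> x xab; rewrite mulr_ge0 // divr_ge0 ?sqrtr_ge0 // oppr_ge0 dphi0.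
- move=> x xab; apply: cvgMl_tmp; apply: cvgM; first by apply: cvgN; exact: cdphi.
  apply: cvgV; first by rewrite lt0r_neq0 // sqrt_gt0.
  apply: continuous_comp; last exact: sqrt_continuous.
  apply: cvgB; first exact: cvg_cst.
  apply: (@continuous_comp _ _ _ phi (fun y : R => y ^+ 2)).
    exact: is_derive_continuous (dphiP x xab).
  exact: exprn_continuous.
- move=> x xab.
  have acos_phi : is_derive x 1 (@acos R \o phi) (- dphi x / Num.sqrt (1 - phi x ^+ 2)).
    rewrite mulNr -mulrN mulrC.
    by apply: is_derive1_comp (dphiP x xab); apply: is_derive1_acos; exact: phi1.
  apply: near_eq_is_derive (@is_deriveZ _ _ _ _ k _ _ _ acos_phi).
  near=> y; have yab : y \in `]a, b[ by near: y; exact: near_in_itvoo.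
  by rewrite /= acos_clip_id // phi1.
- move=> x; apply: cvgMl_tmp; apply: continuous_comp (cphi x) _.
  exact: continuous_acos_clip.
Unshelve. all: by end_near. Qed.

(* Where [1 <= phi x ^+ 2] the integrand has the junk value 0. *)
Lemma integral_acos_clip_comp (phi dphi : R -> R) (a b k : R) : a <= b -> 0 <= k ->
  {in `[a, b], forall x, dphi x < 0} -> {in `[a, b], continuous dphi} ->
  {in `[a, b], forall x, is_derive x (1 : R) phi (dphi x)} ->
  (\int[mu]_(x in `]a, b[) (k * (- dphi x / Num.sqrt (1 - phi x ^+ 2)))%:E =
    (k * (acos_clip (phi b) - acos_clip (phi a)))%:E)%E.
Proof.
move=> ab k0 dphi0 cdphi dphiP.
have cphi : {within `[a, b], continuous phi}.
  apply: continuous_in_subspaceT => x; rewrite inE => xab.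
  exact: is_derive_continuous (dphiP x xab).
have decr : {in `[a, b] &, {homo phi : u v /~ u < v}}.
  apply: ltr0_derive1_lt_cc => // x /subset_itv_oo_cc xab.
    by have := dphiP x xab => ?; exact: ex_derive.
  by have := dphiP x xab => ?; rewrite derive1E derive_val dphi0.
have [c1 [c2 [[ac1 c12 c2b] [inside outside -> ->]]]] :=
  antitone_acos_clip_window ab cphi decr.
rewrite (@integral_subset_support _ _ R mu _ `]c1, c2[%classic); last 2 first.
- by apply: subset_itv; rewrite bnd_simp.
- move=> x /=; rewrite !in_itv /= => xab /negP /(outside _ xab) ge1.
  by rewrite (@ler0_sqrtr _ (1 - _)) ?subr_le0 // invr0 !mulr0.
move: c12; rewrite le_eqVlt => /orP[/eqP <-|c12].
  by rewrite set_itv_ge ?integral_set0 ?subrr ?mulr0 // bnd_simp ltxx.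
have sub x : x \in `[c1, c2] -> x \in `[a, b].
  by rewrite !in_itv /= => /andP[c1x xc2]; rewrite (le_trans ac1) // (le_trans xc2).
have sub_oo x : x \in `]c1, c2[ -> x \in `[a, b] by move=> /subset_itv_oo_cc/sub.
apply: integral_acos_comp => //.
- by move=> x /sub_oo/dphi0/ltW.
- by move=> x /sub_oo; exact: cdphi.
- by move=> x /sub_oo/dphiP.
- exact: continuous_subspaceW cphi.
Qed.

End AcosIntegral.

Lemma sqrtr_sqrM {F : rcfType} (x y : F) :
  0 <= x -> Num.sqrt (x ^+ 2 * y) = x * Num.sqrt y.
Proof. by move=> x0; rewrite sqrtrM ?sqr_ge0 // sqrtr_sqr ger0_norm. Qed.

Section KernelIntegrals.
Context {R : realType}.
Local Notation mu := (@lebesgue_measure R).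
Implicit Types g x v z V k y : R.

Lemma is_derive_affine (p k : R) v : is_derive v (1 : R) (fun v => p + k * v) k.
Proof.
have := is_deriveD (is_derive_cst p v (1 : R)) (is_deriveZ k (is_derive_id v (1 : R))).
by rewrite add0r /GRing.scale /= mulr1.
Qed.

Lemma is_derive_inv_addr z x : x + z != 0 ->
  is_derive x (1 : R) (fun x => (x + z)^-1) (- (x + z) ^- 2).
Proof.
move=> xz; have dshift : is_derive x (1 : R) (fun x => x + z) 1.
  by have := is_derive_affine z 1 x; under eq_fun do rewrite mul1r addrC.
by have := @is_deriveV _ (fun x => x + z) _ _ _ xz dshift; rewrite /GRing.scale /= mulr1.
Qed.

Lemma integral_inv_sqrt_qMP_discr_v g x V : 0 < g -> 0 < x -> x < 1 -> 1 <= V ->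
  (\int[mu]_(v in `]1%R, V[) ((Num.sqrt (- qMP_discr g x v))^-1)%:E =
   (qMP_angle g V x / x)%:E)%E.
Proof.
move=> g0 x0 x1 V1; pose h := 2 * Num.sqrt (g * (1 - x)).
have gx0 : 0 < g * (1 - x) by rewrite mulr_gt0 // subr_gt0.
have h0 : 0 < h by rewrite mulr_gt0 // sqrtr_gt0.
have h2 : h ^+ 2 = 4 * g * (1 - x) by rewrite exprMn sqr_sqrtr ?ltW //; ring.
have h_neq0 := lt0r_neq0 h0; have x_neq0 := lt0r_neq0 x0.
have cos_sqr v : 1 - qMP_cos g v x ^+ 2 = h^-1 ^+ 2 * - qMP_discr g x v.
  by rewrite /qMP_discr -h2 /qMP_cos -/h; field.
have cos_at1 : 1 <= qMP_cos g 1 x.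
  rewrite ler_pdivlMr // mul1r mulr1 -(@ler_pXn2r _ 2) ?nnegrE ?(ltW h0) //; last by lra.
  by rewrite h2 -subr_ge0; have := sqr_ge0 (g - (1 - x)); lra.
transitivity (\int[mu]_(v in `]1%R, V[)
    (x^-1 * (- - (x / h) / Num.sqrt (1 - qMP_cos g v x ^+ 2)))%:E)%E.
  apply: eq_integral => v _; congr EFin.
  rewrite cos_sqr sqrtr_sqrM ?invr_ge0 ?(ltW h0) // (invfM h^-1) invrK.
  by move: (_^-1) => S; field; rewrite x_neq0 h_neq0.
rewrite (@integral_acos_clip_comp _ (qMP_cos g ^~ x) (fun=> - (x / h))) //.
- by rewrite (acos_clip_ge1 cos_at1) subr0 mulrC.
- by rewrite invr_ge0 ltW.
- by move=> v _; rewrite oppr_lt0 divr_gt0.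
- by move=> v _; exact: cst_continuous.
- move=> v _; have := is_derive_affine ((1 + g) / h) (- (x / h)) v.
  by under eq_fun do rewrite mulNr mulrAC -mulrBl.
Qed.

End KernelIntegrals.

Section ResolventCos.
Context {R : realType}.
Local Notation mu := (@lebesgue_measure R).
Variables (g z v : R).
Hypotheses (g_gt0 : 0 < g) (g_le1 : g <= 1) (z_gt0 : 0 < z) (v_gt1 : 1 < v).
Local Notation D := (qMP_discr g (- z) v).
Let mid := v * (1 + g + z * v) - 2 * g.
Let h := 2 * Num.sqrt (g * (v - 1) * (v - g)).

(* [- qMP_discr g x v] is a quadratic polynomial in [(x + z)^-1] times [(x + z) ^+ 2];
   [resolvent_cos] maps the two roots of the polynomial to 1 and -1. *)
Definition resolvent_cos (x : R) := (D * (x + z)^-1 - mid) / h.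

Let discr_gt0 : 0 < D.
Proof. by apply: qMP_discrN_gt0 => //; exact: ltW. Qed.

Let gv_gt0 : 0 < g * (v - 1) * (v - g).
Proof. by rewrite !mulr_gt0 ?subr_gt0 // (le_lt_trans g_le1). Qed.

Let h_gt0 : 0 < h. Proof. by rewrite mulr_gt0 // sqrtr_gt0. Qed.
Let h_neq0 : h != 0. Proof. exact: lt0r_neq0. Qed.

Let h2 : h ^+ 2 = mid ^+ 2 - v ^+ 2 * D.
Proof. by rewrite exprMn sqr_sqrtr ?ltW // /mid qMP_discrN; ring. Qed.

Lemma onem_resolvent_cos_sqr x : 0 < x + z -> 1 - resolvent_cos x ^+ 2 =
  (Num.sqrt D / ((x + z) * h)) ^+ 2 * - qMP_discr g x v.
Proof.
move=> /lt0r_neq0 xz.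
have numE : h ^+ 2 - (D * (x + z)^-1 - mid) ^+ 2 =
    Num.sqrt D ^+ 2 * - qMP_discr g x v / (x + z) ^+ 2.
  rewrite h2 /mid sqr_sqrtr ?(ltW discr_gt0) // qMP_discrN /qMP_discr.
  by field.
transitivity ((h ^+ 2 - (D * (x + z)^-1 - mid) ^+ 2) / h ^+ 2).
  by rewrite /resolvent_cos; field; rewrite h_neq0 xz.
by rewrite numE; field; rewrite h_neq0 xz.
Qed.

Lemma resolvent_cos_sqr_ge1 x : 0 < x + z -> 0 <= qMP_discr g x v ->
  1 <= resolvent_cos x ^+ 2.
Proof.
move=> xz Dx; rewrite -subr_le0 onem_resolvent_cos_sqr //.
by rewrite mulrN oppr_le0 mulr_ge0 ?sqr_ge0.
Qed.

Lemma resolvent_cos0_ge1 : 1 <= resolvent_cos 0.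
Proof.
have cos_ge0 : 0 <= resolvent_cos 0.
  rewrite /resolvent_cos add0r divr_ge0 ?(ltW h_gt0) // subr_ge0 ler_pdivlMr //.
  rewrite qMP_discrN /mid; have := sqr_ge0 (1 - g).
  have vg : 1 + g <= v * (1 + g) by rewrite ler_peMl ?(ltW v_gt1) // addr_ge0 // ltW.
  have : 0 <= z * (v * (1 + g) - 2 * g); last by lra.
  by rewrite mulr_ge0 ?(ltW z_gt0) //; move: g_le1; lra.
rewrite -(@ler_pXn2r _ 2) ?nnegrE // expr1n resolvent_cos_sqr_ge1 ?add0r //.
by rewrite /qMP_discr mul0r !subr0 mulr1; have := sqr_ge0 (1 - g); lra.
Qed.

Lemma resolvent_cos1_leN1 : resolvent_cos 1 <= -1.
Proof.
have z1 : 0 < 1 + z by rewrite addr_gt0.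
have cos_le0 : resolvent_cos 1 <= 0.
  rewrite /resolvent_cos pmulr_lle0 ?invr_gt0 // subr_le0 ler_pdivrMr // qMP_discrN /mid.
  have : (1 + g + z * v) * (1 + g - v) <= 2 * (1 + z) * g; last by lra.
  have zv0 : 0 < z * v by rewrite mulr_gt0 // (lt_trans ltr01).
  have [vg|gv] := leP (1 + g) v.
    apply: (@le_trans _ _ 0); last by rewrite !mulr_ge0 // ltW.
    by apply: mulr_ge0_le0; move: g_gt0; lra.
  have zvg : z * v <= z * (1 + g) by rewrite ler_wpM2l // ltW.
  have zg : z * g <= z by rewrite ler_piMr // ltW.
  by apply: ler_pM; move: g_gt0 g_le1 v_gt1; lra.
rewrite lerNr -(@ler_pXn2r _ 2) ?nnegrE ?oppr_ge0 // expr1n sqrrN.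
rewrite resolvent_cos_sqr_ge1 // /qMP_discr subrr mulr0 subr0 mul1r.
exact: sqr_ge0.
Qed.

Lemma is_derive_resolvent_cos x : 0 < x + z ->
  is_derive x (1 : R) resolvent_cos (- (Num.sqrt D ^+ 2 / h / (x + z) ^+ 2)).
Proof.
move=> /lt0r_neq0 xz.
have := @is_derive1_comp _ (fun y => - mid / h + D / h * y) (fun x => (x + z)^-1)
  x _ _ (is_derive_affine _ _ _) (is_derive_inv_addr xz).
rewrite mulrN sqr_sqrtr ?(ltW discr_gt0) //; apply: near_eq_is_derive.
by near=> y; rewrite /resolvent_cos /=; ring.
Unshelve. all: by end_near. Qed.

Lemma integral_inv_sqrt_qMP_discr_x :
  (\int[mu]_(x in `]0%R, 1%R[) ((x + z)^-1 * (Num.sqrt (- qMP_discr g x v))^-1)%:E =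
   (pi / Num.sqrt (qMP_discr g (- z) v))%:E)%E.
Proof.
have S0 : 0 < Num.sqrt D by rewrite sqrtr_gt0.
have S_neq0 := lt0r_neq0 S0.
pose dcos x := - (Num.sqrt D ^+ 2 / h / (x + z) ^+ 2).
have xz x : x \in `[0, 1] -> 0 < x + z.
  by rewrite in_itv /= => /andP[x0 _]; rewrite ltr_wpDl.
transitivity (\int[mu]_(x in `]0%R, 1%R[)
    ((Num.sqrt D)^-1 * (- dcos x / Num.sqrt (1 - resolvent_cos x ^+ 2)))%:E)%E.
  apply: eq_integral => x; rewrite inE => /subset_itv_oo_cc/xz x0; congr EFin.
  have c0 : 0 <= Num.sqrt D / ((x + z) * h).
    by rewrite divr_ge0 ?sqrtr_ge0 // mulr_ge0 // ltW.
  rewrite onem_resolvent_cos_sqr // sqrtr_sqrM // [in RHS]invfM /dcos.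
  move: (Num.sqrt (- _))^-1 (lt0r_neq0 x0) => T x_neq0.
  by field; rewrite x_neq0 h_neq0 S_neq0.
have -> : pi / Num.sqrt D =
    (Num.sqrt D)^-1 * (acos_clip (resolvent_cos 1) - acos_clip (resolvent_cos 0)).
  rewrite (acos_clip_leN1 resolvent_cos1_leN1) (acos_clip_ge1 resolvent_cos0_ge1).
  by rewrite subr0 mulrC.
apply: integral_acos_clip_comp.
- exact: ler01.
- by rewrite invr_ge0 sqrtr_ge0.
- by move=> x /xz x0; rewrite oppr_lt0 !divr_gt0 // exprn_gt0.
- move=> x /xz x0; apply: cvgN; apply: cvgMl_tmp.
  apply: cvgV; first by rewrite lt0r_neq0 // exprn_gt0.
  apply: (@continuous_comp _ _ _ (+%R^~ z) (fun y : R => y ^+ 2)).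
    by apply: cvgD; [exact: cvg_id|exact: cvg_cst].
  exact: exprn_continuous.
- by move=> x /xz; exact: is_derive_resolvent_cos.
Qed.

End ResolventCos.

(** * The Stieltjes transform of the density *)

Section LnResolventRootIntegral.
Context {R : realType}.
Local Notation mu := (@lebesgue_measure R).

Lemma is_derive_ln_add_sqrt (k y : R) : 0 < y -> k < y ^+ 2 ->
  is_derive y 1 (fun y => ln (y + Num.sqrt (y ^+ 2 - k))) (Num.sqrt (y ^+ 2 - k))^-1.
Proof.
move=> y0; rewrite -subr_gt0 => yk0; set S := Num.sqrt (y ^+ 2 - k).
have S0 : 0 < S by rewrite sqrtr_gt0.
have dsqr : is_derive y 1 (fun y : R => y ^+ 2 - k) (2 * y).
  rewrite [X in is_derive _ _ X _](_ : _ = @id R ^+ 2 - cst k); last exact/funext.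
  by apply: is_derive_eq; rewrite subr0 expr1 /GRing.scale /= mulr1 mulr_natl.
have dsum := is_deriveD (@is_derive_id _ _ y 1)
  (@is_derive1_comp _ Num.sqrt _ y _ _ (is_derive1_sqrt yk0) dsqr).
have sum0 : 0 < y + S by rewrite addr_gt0.
have dln := @is_derive1_comp _ (@ln R) _ y _ _ (is_derive1_ln sum0) dsum.
apply: (@is_derive_eq _ _ _ _ _ _ _ _ dln); rewrite -/S; field.
by rewrite !lt0r_neq0.
Qed.

Variables (g z : R).
Hypotheses (g_gt0 : 0 < g) (g_le1 : g <= 1) (z_gt0 : 0 < z).

Lemma resolvent_root1 : resolvent_root g z 1 = 1.
Proof.
rewrite /resolvent_root qMP_discrN mulr1.
have -> : (1 + g + z) ^+ 2 - 4 * g * (1 + z) = (1 + z - g) ^+ 2 by ring.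
rewrite sqrtr_sqr ger0_norm; last by move: g_le1 z_gt0; lra.
by field; rewrite lt0r_neq0 // addr_gt0.
Qed.

Let root_num v := 1 + g + z * v + Num.sqrt (qMP_discr g (- z) v).

Let discr_gt0 v : 1 <= v -> 0 < qMP_discr g (- z) v.
Proof. by move=> v1; apply: qMP_discrN_gt0 => //; exact: ltW. Qed.

Let affine_gt0 v : 1 <= v -> 0 < 1 + g + z * v.
Proof. by move=> v1; rewrite !addr_gt0 // mulr_gt0 // (lt_le_trans ltr01). Qed.

Lemma ln_resolvent_root v : 1 <= v ->
  ln (resolvent_root g z v) = ln (root_num v) - ln (2 * (1 + z)).
Proof.
move=> v1; rewrite /resolvent_root ln_div // posrE.
  by rewrite addr_gt0 ?affine_gt0 // sqrtr_gt0 discr_gt0.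
by rewrite mulr_gt0 // addr_gt0.
Qed.

Lemma is_derive_ln_root_num (v : R) : 1 <= v ->
  is_derive v (1 : R) (@ln R \o root_num) (z / Num.sqrt (qMP_discr g (- z) v)).
Proof.
move=> v1; have := discr_gt0 v1; rewrite qMP_discrN subr_gt0 => discr.
have := @is_derive1_comp _ _ (fun v => 1 + g + z * v) v _ _
  (is_derive_ln_add_sqrt (affine_gt0 v1) discr) (is_derive_affine (1 + g) z v).
rewrite [_ * z]mulrC; apply: near_eq_is_derive.
by near=> w; rewrite /= /root_num qMP_discrN.
Unshelve. all: by end_near. Qed.

Lemma continuous_qMP_discrN : continuous (qMP_discr g (- z)).
Proof.
rewrite (_ : qMP_discr g (- z) = fun v => (1 + g + z * v) ^+ 2 - 4 * g * (1 + z)).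
  move=> v; apply: cvgB; last exact: cvg_cst.
  apply: (@continuous_comp _ _ _ (fun v => 1 + g + z * v) (fun y : R => y ^+ 2)).
    exact: is_derive_continuous (is_derive_affine _ _ _).
  exact: exprn_continuous.
by apply/funext => v; rewrite qMP_discrN.
Qed.

Lemma integral_inv_sqrt_qMP_discrN V : 1 < V ->
  (\int[mu]_(v in `]1%R, V[) (z / Num.sqrt (qMP_discr g (- z) v))%:E =
   (ln (resolvent_root g z V))%:E)%E.
Proof.
move=> V1.
have -> : ln (resolvent_root g z V) = ln (root_num V) - ln (root_num 1).
  have /eqP := ln_resolvent_root (lexx 1).
  rewrite resolvent_root1 ln1 eq_sym subr_eq0 => /eqP ->.
  by rewrite ln_resolvent_root // ltW.
apply: (ge0_continuous_FTC2_oo (F := @ln R \o root_num)) => //.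
- by move=> v _; rewrite divr_ge0 ?sqrtr_ge0 // ltW.
- move=> v; rewrite in_itv /= => /andP[/ltW v1 _]; apply: cvgMl_tmp.
  apply: cvgV; first by rewrite lt0r_neq0 // sqrtr_gt0 discr_gt0.
  apply: continuous_comp; first exact: continuous_qMP_discrN.
  exact: sqrt_continuous.
- by move=> v; rewrite in_itv /= => /andP[/ltW v1 _]; exact: is_derive_ln_root_num.
- apply: continuous_in_subspaceT => v; rewrite inE /= in_itv /= => /andP[v1 _].
  exact: is_derive_continuous (is_derive_ln_root_num v1).
Qed.

End LnResolventRootIntegral.

Section FubiniTonelliProduct.
Local Open Scope ereal_scope.

Lemma fubini_tonelli_setX d1 d2 (T1 : measurableType d1) (T2 : measurableType d2)
    (R : realType) (m1 : {sigma_finite_measure set T1 -> \bar R})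
    (m2 : {sigma_finite_measure set T2 -> \bar R}) (A : set T1) (B : set T2)
    (f : T1 * T2 -> \bar R) :
  measurable A -> measurable B -> measurable_fun (A `*` B) f ->
  (forall x y, A x -> B y -> 0 <= f (x, y)) ->
  \int[m1]_(x in A) \int[m2]_(y in B) f (x, y) =
  \int[m2]_(y in B) \int[m1]_(x in A) f (x, y).
Proof.
move=> mA mB mf f0; pose h := f \_ (A `*` B).
have mh : measurable_fun setT h.
  exact: (measurable_restrictT f (measurableX mA mB)).1 mf.
have h0 p : 0 <= h p.
  by rewrite /h patchE; case: ifPn => // /set_mem; case: p => x y [] /=; exact: f0.
have := fubini_tonelli (m1 := m1) (m2 := m2) h mh h0.
have -> : \int[m1]_x \int[m2]_y h (x, y) = \int[m1]_(x in A) \int[m2]_(y in B) f (x, y).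
  rewrite [RHS]integral_mkcond; apply: eq_integral => x _; rewrite patchE.
  case: ifPn => xA; last first.
    by rewrite integral0_eq // => y _; rewrite /h patchE in_setX (negbTE xA).
  rewrite [RHS]integral_mkcond; apply: eq_integral => y _.
  by rewrite /h !patchE in_setX xA.
have -> // : \int[m2]_y \int[m1]_x h (x, y) =
    \int[m2]_(y in B) \int[m1]_(x in A) f (x, y).
rewrite [RHS]integral_mkcond; apply: eq_integral => y _; rewrite patchE.
case: ifPn => yB; last first.
  by rewrite integral0_eq // => x _; rewrite /h patchE in_setX (negbTE yB) andbF.
rewrite [RHS]integral_mkcond; apply: eq_integral => x _.
by rewrite /h !patchE in_setX yB andbT.
Qed.

End FubiniTonelliProduct.

Section AngleStieltjesTransform.
Context {R : realType}.
Local Notation mu := (@lebesgue_measure R).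

Lemma measurable_fun_setD1 (A : set R) (r : R) (h : R -> R) : measurable A ->
  measurable_fun (A `\ r) h -> measurable_fun A h.
Proof.
move=> mA mh; have [Ar|nAr] := pselect (A r); last by rewrite -(not_setD1 nAr).
rewrite -(setD1K Ar); apply/measurable_funU => //; first exact: measurableD.
by split => //; exact: measurable_fun_set1.
Qed.

Lemma measurable_inv : measurable_fun setT (@GRing.inv R).
Proof.
apply: (@measurable_fun_setD1 _ 0) => //.
have -> : [set: R] `\ 0 = [set x | x != 0].
  by apply/seteqP; split => x /= => [[_ /eqP]|/eqP].
apply: open_continuous_measurable_fun; first exact: open_neq.
by move=> x; rewrite inE => x0; exact: inv_continuous.
Qed.

Lemma measurable_inv_sqrt d (T : measurableType d) (D : set T) (h : T -> R) :
  measurable_fun D h -> measurable_fun D (fun x => (Num.sqrt (h x))^-1).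
Proof.
move=> mh; apply: (measurableT_comp measurable_inv).
apply: measurableT_comp mh; apply: continuous_measurable_fun.
exact: sqrt_continuous.
Qed.

Lemma measurable_qMP_discr d (T : measurableType d) (g : R) (D : set T) (x v : T -> R) :
  measurable_fun D x -> measurable_fun D v ->
  measurable_fun D (fun t => qMP_discr g (x t) (v t)).
Proof.
move=> mx mv; apply: measurable_funB; last first.
  by apply: measurable_funM => //; apply: measurable_funB.
by apply: measurable_funX; apply: measurable_funB => //; exact: measurable_funM.
Qed.

Lemma integral_qMP_angle (g z V : R) : 0 < g -> g <= 1 -> 0 < z -> 1 < V ->
  (\int[mu]_(x in `]0%R, 1%R[) ((x + z)^-1 * (qMP_angle g V x / x))%:E =
   (pi / z * ln (resolvent_root g z V))%:E)%E.
Proof.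
move=> g0 g1 z0 V1.
pose kernel (p : R * R) := (p.1 + z)^-1 * (Num.sqrt (- qMP_discr g p.1 p.2))^-1.
have minvsqrt d (T : measurableType d) (A : set T) (x v : T -> R) :
    measurable_fun A x -> measurable_fun A v ->
    measurable_fun A (fun t => (Num.sqrt (- qMP_discr g (x t) (v t)))^-1).
  move=> mx mv; apply: measurable_inv_sqrt; apply: measurableT_comp => //.
  exact: measurable_qMP_discr.
transitivity (\int[mu]_(x in `]0%R, 1%R[) \int[mu]_(v in `]1%R, V[) (kernel (x, v))%:E)%E.
  apply: eq_integral => x; rewrite inE /= in_itv /= => /andP[x0 x1].
  rewrite /kernel /=; under eq_integral do rewrite EFinM.
  rewrite ge0_integralZl_EFin ?invr_ge0 ?addr_ge0 ?ltW //=.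
  - by rewrite integral_inv_sqrt_qMP_discr_v // ltW.
  - by apply/measurable_EFinP; exact: minvsqrt.
rewrite (@fubini_tonelli_setX _ _ _ _ R mu mu _ _ (EFin \o kernel)) //; last 2 first.
- apply/measurable_EFinP; apply: measurable_funTS.
  apply: measurable_funM; last exact: minvsqrt.
  by apply: (measurableT_comp measurable_inv); apply: measurable_funD.
- move=> x v /=; rewrite in_itv /= => /andP[x0 _] _.
  by rewrite lee_fin mulr_ge0 ?invr_ge0 ?sqrtr_ge0 // addr_ge0 // ltW.
transitivity (\int[mu]_(v in `]1%R, V[)
    ((pi / z)%:E * (z / Num.sqrt (qMP_discr g (- z) v))%:E))%E.
  apply: eq_integral => v; rewrite inE /= in_itv /= => /andP[v1 _].
  rewrite integral_inv_sqrt_qMP_discr_x // -EFinM; congr EFin.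
  by rewrite mulrA divfK // lt0r_neq0.
rewrite ge0_integralZl_EFin ?divr_ge0 ?pi_ge0 ?ltW //.
- by rewrite integral_inv_sqrt_qMP_discrN.
- by move=> v _; rewrite lee_fin divr_ge0 ?sqrtr_ge0 // ltW.
- apply/measurable_EFinP; apply: measurable_funM => //.
  by apply: measurable_inv_sqrt; exact: measurable_qMP_discr.
Qed.

End AngleStieltjesTransform.

(** * Density of the resolvents *)

Section Weierstrass.
Context {R : realType}.

(* [(bernstein n phi).[x]] is the expectation of [phi] under the binomial law (n, x),
   defined by conditioning on the first trial. *)
Fixpoint bernstein (n : nat) (phi : nat -> R) : {poly R} :=
  if n is m.+1 then
    'X * bernstein m (fun k => phi k.+1) + (1 - 'X) * bernstein m phi
  else (phi 0%N)%:P.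

Lemma bernsteinS n phi x : (bernstein n.+1 phi).[x] =
  x * (bernstein n (fun k => phi k.+1)).[x] + (1 - x) * (bernstein n phi).[x].
Proof. by rewrite /= !(hornerD, hornerM, hornerN, hornerX, hornerC). Qed.

Lemma bernstein_le n phi psi x : 0 <= x -> x <= 1 ->
  (forall k, (k <= n)%N -> phi k <= psi k) ->
  (bernstein n phi).[x] <= (bernstein n psi).[x].
Proof.
move=> x0 x1; elim: n phi psi => [|n IH] phi psi phi_psi.
  by rewrite /= !hornerC phi_psi.
rewrite !bernsteinS lerD // ler_wpM2l ?subr_ge0 //; apply: IH => k kn.
  exact: phi_psi.
by apply: phi_psi; exact: leqW.
Qed.

Lemma bernstein_quadratic n (u v w x : R) :
  (bernstein n (fun k => u + v * k%:R + w * k%:R ^+ 2)).[x] =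
  u + v * (n%:R * x) + w * (n%:R * x + n%:R * (n%:R - 1) * x ^+ 2).
Proof.
elim: n u v w => [|n IH] u v w; first by rewrite /= hornerC; ring.
rewrite bernsteinS IH.
have -> : (fun k => u + v * k.+1%:R + w * k.+1%:R ^+ 2) =
    (fun k => (u + v + w) + (v + 2 * w) * k%:R + w * k%:R ^+ 2 :> R).
  by apply/funext => k; rewrite -natr1; ring.
by rewrite IH -natr1; ring.
Qed.

(* The variance of the binomial law (n, x) is n x (1 - x). *)
Lemma bernstein_dist n (phi : nat -> R) (y e K x : R) : 0 <= x -> x <= 1 ->
  (forall k, (k <= n)%N -> `|phi k - y| <= e + K * (k%:R - n%:R * x) ^+ 2) ->
  `|(bernstein n phi).[x] - y| <= e + K * (n%:R * (x * (1 - x))).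
Proof.
move=> x0 x1 phi_y.
pose upper c k : R := (y + c * e + c * K * (n%:R * x) ^+ 2) +
  (- (2 * (c * K) * n%:R * x)) * k%:R + (c * K) * k%:R ^+ 2.
have upperE (c : R) k : upper c k = y + c * (e + K * (k%:R - n%:R * x) ^+ 2).
  by rewrite /upper; ring.
have bernstein_upper (c : R) : (bernstein n (upper c)).[x] =
    y + c * (e + K * (n%:R * (x * (1 - x)))).
  by rewrite bernstein_quadratic; ring.
rewrite ler_norml; apply/andP; split.
- rewrite lerBrDl; have := bernstein_upper (-1); rewrite mulN1r => <-.
  apply: bernstein_le => // k /phi_y; rewrite ler_norml => /andP[+ _].
  by rewrite upperE mulN1r lerBrDl.
- rewrite lerBlDl; have := bernstein_upper 1; rewrite mul1r => <-.
  apply: bernstein_le => // k /phi_y; rewrite ler_norml => /andP[_].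
  by rewrite upperE mul1r lerBlDl.
Qed.

Lemma segment_continuous_uniform (f : R -> R) (a b e : R) :
  {within `[a, b], continuous f} -> 0 < e ->
  exists2 d, 0 < d & {in `[a, b] &, forall x y, `|x - y| < d -> `|f x - f y| < e}.
Proof.
move=> /subspace_continuousP cf e0.
pose close_images d x := x \in `[a, b] ->
  forall y, y \in `[a, b] -> `|x - y| < d -> `|f x - f y| < e.
have /compact_near_coveringP cover := @segment_compact R a b.
have near_close : \forall d \near 0^'+, `[a, b]%classic `<=` close_images d.
  apply: (cover _ _ close_images) => x0 x0ab; have e2 : 0 < e / 2 by rewrite divr_gt0.
  have /cvgrPdist_lt/(_ _ e2) := cf x0 x0ab.
  rewrite near_withinE => /nbhs_ballP[r /= r0 rP].
  exists (ball x0 (r / 2), [set d : R | d < r / 2]).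
    split; first by exists (r / 2); rewrite //= divr_gt0.
    by apply: nbhs_right_lt; rewrite divr_gt0.
  move=> [x d] /= [x0x dr] xab y yab xyd.
  have fx : `|f x0 - f x| < e / 2.
    by apply: rP => //; apply: (@le_ball _ _ _ (r / 2)) => //; lra.
  have fy : `|f x0 - f y| < e / 2.
    apply: rP => //; rewrite /ball /=; apply: le_lt_trans (ler_distD x _ _) _.
    by move: x0x; rewrite /ball /=; lra.
  by apply: le_lt_trans (ler_distD (f x0) _ _) _; rewrite (distrC (f x)); lra.
have [d [d0 dP]] : exists d, 0 < d /\ `[a, b]%classic `<=` close_images d.
  apply: (@filter_ex _ (0^'+)); near=> d; split; near: d => //.
  exact: nbhs_right_gt.
by exists d => // x y xab yab; exact: dP.
Unshelve. all: by end_near. Qed.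

Lemma segment_continuous_bounded (f : R -> R) (a b : R) : a <= b ->
  {within `[a, b], continuous f} ->
  exists2 M, 0 <= M & {in `[a, b], forall x, `|f x| <= M}.
Proof.
move=> ab /subspace_continuousP cf.
have cnorm : {within `[a, b], continuous (fun x => `|f x|)}.
  by apply/subspace_continuousP => x /cf; exact: cvg_norm.
by have [c _ cP] := EVT_max ab cnorm; exists `|f c|.
Qed.

Lemma segment_continuous_quadratic_modulus (f : R -> R) (a b e : R) : a <= b ->
  {within `[a, b], continuous f} -> 0 < e ->
  exists2 K, 0 <= K &
    {in `[a, b] &, forall x y, `|f x - f y| <= e + K * (x - y) ^+ 2}.
Proof.
move=> ab cf e0; have [M M0 fM] := segment_continuous_bounded ab cf.
have [d d0 dP] := segment_continuous_uniform cf e0.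
have d2 : d ^+ 2 != 0 by rewrite expf_neq0 // lt0r_neq0.
have K0 : 0 <= 2 * M / d ^+ 2 by rewrite divr_ge0 ?sqr_ge0 // mulr_ge0.
exists (2 * M / d ^+ 2) => // x y xin yin; have [xy|xy] := ltP `|x - y| d.
  by apply: le_trans (ltW (dP _ _ xin yin xy)) _; rewrite lerDl mulr_ge0 ?sqr_ge0.
apply: le_trans (ler_normB _ _) _; apply: le_trans (lerD (fM _ xin) (fM _ yin)) _.
apply: (@le_trans _ _ (2 * M / d ^+ 2 * d ^+ 2)); first by rewrite divfK //; lra.
apply: ler_wpDl; first exact: ltW.
rewrite ler_wpM2l // -(real_normK (num_real (x - y))).
by rewrite lerXn2r // nnegrE // ltW.
Qed.

Lemma weierstrass_approx (f : R -> R) (e : R) :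
  {within `[0, 1], continuous f} -> 0 < e ->
  exists p : {poly R}, {in `[0, 1], forall x, `|f x - p.[x]| <= e}.
Proof.
move=> cf e0.
have e2 : 0 < e / 2 by rewrite divr_gt0.
have [K K0 f_dist] := segment_continuous_quadratic_modulus ler01 cf e2.
pose n := (Num.bound (2 * K / e)).+1.
have n0 : 0 < n%:R :> R by rewrite ltr0n.
have n_large : K / n%:R <= e / 2.
  have bound : 2 * K / e <= n%:R.
    apply: le_trans (ltW (archi_boundP _)) _; last by rewrite ler_nat.
    by rewrite divr_ge0 ?(ltW e0) // mulr_ge0.
  by move: bound; rewrite !ler_pdivrMr //; lra.
exists (bernstein n (fun k => f (k%:R / n%:R))) => x xin.
have := xin; rewrite in_itv /= => /andP[x0 x1]; rewrite distrC.
have variance : K / n%:R ^+ 2 * (n%:R * (x * (1 - x))) <= e / 2.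
  have -> : K / n%:R ^+ 2 * (n%:R * (x * (1 - x))) = K / n%:R * (x * (1 - x)).
    by field; rewrite lt0r_neq0.
  apply: le_trans n_large; rewrite ler_piMr ?divr_ge0 ?(ltW n0) //.
  by rewrite mulr_ile1 ?subr_ge0 // gerBl.
apply: le_trans (@bernstein_dist n _ (f x) (e / 2) (K / n%:R ^+ 2) x x0 x1 _) _;
  last by lra.
move=> k kn; have kin : k%:R / n%:R \in `[0, 1 : R].
  by rewrite in_itv /= divr_ge0 ?ler0n //= ler_pdivrMr // mul1r ler_nat.
apply: le_trans (f_dist _ _ kin xin) _; rewrite lerD2l le_eqVlt; apply/orP; left.
by apply/eqP; field; rewrite lt0r_neq0.
Qed.

End Weierstrass.

Section ResolventDensity.
Context {R : realType}.
Implicit Types (f h : R -> R) (s : seq (R * R)) (a z e : R).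

Definition resolvent_comb s x := \sum_(cz <- s) cz.1 * (x + cz.2)^-1.

Lemma resolvent_comb_nil : resolvent_comb [::] = fun=> 0.
Proof. by apply: funext => x; exact: big_nil. Qed.

Lemma resolvent_comb_cons a z s :
  resolvent_comb ((a, z) :: s) = fun x => a * (x + z)^-1 + resolvent_comb s x.
Proof. by apply: funext => x; exact: big_cons. Qed.

Definition resolvent_approximable f := forall e, 0 < e ->
  exists2 s, all (fun cz => 0 < cz.2) s &
    {in `[0, 1], forall x, `|f x - resolvent_comb s x| <= e}.

Lemma resolvent_approximable_uniform f :
  (forall e, 0 < e -> exists2 h, resolvent_approximable h &
    {in `[0, 1], forall x, `|f x - h x| <= e}) -> resolvent_approximable f.
Proof.
move=> approx e e0; have e2 : 0 < e / 2 by rewrite divr_gt0.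
have [h /(_ _ e2)[s s0 hs] fh] := approx _ e2; exists s => // x xin.
apply: le_trans (ler_distD (h x) _ _) _.
by have := fh x xin; have := hs x xin; lra.
Qed.

Lemma resolvent_approximable_eq f h : {in `[0, 1], f =1 h} ->
  resolvent_approximable h -> resolvent_approximable f.
Proof.
move=> fh happrox; apply: resolvent_approximable_uniform => e e0.
by exists h => // x /fh ->; rewrite subrr normr0 ltW.
Qed.

Lemma resolvent_approximable_affine a f h :
  resolvent_approximable f -> resolvent_approximable h ->
  resolvent_approximable (fun x => a * f x + h x).
Proof.
move=> fapprox happrox e e0.
have a1 : 0 < `|a| + 1 by rewrite ltr_wpDl.
have ea : 0 < e / 2 / (`|a| + 1) by rewrite !divr_gt0.
have [s s0 fs] := fapprox _ ea; have [t t0 ht] := happrox _ (divr_gt0 e0 (ltr0n R 2)).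
exists ([seq (a * cz.1, cz.2) | cz <- s] ++ t).
  by rewrite all_cat t0 andbT all_map.
move=> x xin; rewrite /resolvent_comb big_cat big_map /=.
under eq_bigr do rewrite -mulrA; rewrite -mulr_sumr opprD addrACA -mulrBr.
apply: le_trans (ler_normD _ _) _; rewrite normrM.
have af : `|a| * `|f x - resolvent_comb s x| <= e / 2.
  apply: le_trans (ler_pM _ _ (_ : `|a| <= `|a| + 1) (fs x xin)) _ => //.
    by rewrite lerDl.
  by rewrite mulrC divfK // lt0r_neq0.
by have := ht x xin; move: af; rewrite /resolvent_comb; lra.
Qed.

Lemma resolvent_approximable_resolvent z : 0 < z ->
  resolvent_approximable (fun x => (x + z)^-1).
Proof.
move=> z0 e e0; exists [:: (1, z)]; first by rewrite /= z0.
by move=> x _; rewrite /resolvent_comb big_seq1 mul1r subrr normr0 ltW.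
Qed.

(* [z x^k / (x + z)] tends to [x^k] uniformly as [z] tends to infinity. *)
Lemma resolvent_approximable_expr_of_div k :
  (forall z, 0 < z -> resolvent_approximable (fun x => x ^+ k / (x + z))) ->
  resolvent_approximable (fun x => x ^+ k).
Proof.
move=> divapprox; apply: resolvent_approximable_uniform => e e0.
have z0 : 0 < e^-1 by rewrite invr_gt0.
exists (fun x => (e^-1 - 1) * (x ^+ k / (x + e^-1)) + x ^+ k / (x + e^-1)).
  by apply: resolvent_approximable_affine; exact: divapprox.
move=> x; rewrite in_itv /= => /andP[x0 x1].
have xz : 0 < x + e^-1 by rewrite ltr_wpDl.
have xk1 : x ^+ k.+1 <= 1 by rewrite exprn_ile1.
have -> : x ^+ k - ((e^-1 - 1) * (x ^+ k / (x + e^-1)) + x ^+ k / (x + e^-1)) =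
    x ^+ k.+1 / (x + e^-1).
  by rewrite exprS; move: (e^-1) xz => z /lt0r_neq0 xz; field.
rewrite ger0_norm; last by rewrite divr_ge0 ?exprn_ge0 // ltW.
rewrite ler_pdivrMr // mulrDr mulfV ?lt0r_neq0 //.
by apply: le_trans xk1 _; rewrite lerDr mulr_ge0 // ltW.
Qed.

(* [x^(k+1) / (x + z) = x^k - z x^k / (x + z)]. *)
Lemma resolvent_approximable_expr_div k z : 0 < z ->
  resolvent_approximable (fun x => x ^+ k / (x + z)).
Proof.
elim: k z => [|k IH] z z0.
  apply: resolvent_approximable_eq (resolvent_approximable_resolvent z0) => x _.
  by rewrite expr0 mul1r.
apply: resolvent_approximable_eq (resolvent_approximable_affine (- z) (IH z z0)
  (resolvent_approximable_expr_of_div IH)) => x.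
rewrite in_itv /= => /andP[x0 _].
by rewrite exprS; field; rewrite lt0r_neq0 // ltr_wpDl.
Qed.

Lemma resolvent_approximable_horner (p : {poly R}) :
  resolvent_approximable (horner p).
Proof.
suff approx_sum n : resolvent_approximable (fun x => \sum_(i < n) p`_i * x ^+ i).
  by apply: resolvent_approximable_eq (approx_sum (size p)) => x _; exact: horner_coef.
elim: n => [|n IH].
  move=> e e0; exists [::] => // x _.
  by rewrite resolvent_comb_nil big_ord0 subrr normr0 ltW.
apply: resolvent_approximable_eq (resolvent_approximable_affine p`_n
  (resolvent_approximable_expr_of_div (resolvent_approximable_expr_div n)) IH) => x _.
by rewrite big_ord_recr /= addrC.
Qed.

Lemma resolvent_approximable_continuous f : {within `[0, 1], continuous f} ->
  resolvent_approximable f.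
Proof.
move=> cf; apply: resolvent_approximable_uniform => e /(weierstrass_approx cf)[p fp].
by exists (horner p); first exact: resolvent_approximable_horner.
Qed.

End ResolventDensity.

Section WeightedIntegral.
Context {R : realType}.
Local Notation mu := (@lebesgue_measure R).
Local Notation D := (`]0%R, 1%R[%classic : set R).
Implicit Types f h w : R -> R.

Lemma segment_continuous_measurable (a b : R) f : {within `[a, b], continuous f} ->
  measurable_fun `]a, b[ f.
Proof.
move=> cf; apply: (@measurable_funS _ _ _ _ `[a, b]%classic) => //.
  exact: subset_itv_oo_cc.
exact: subspace_continuous_measurable_fun.
Qed.

Lemma segment_continuous_resolvent (z : R) : 0 < z ->
  {within `[0, 1], continuous (fun x : R => (x + z)^-1)}.
Proof.
move=> z0; apply: continuous_in_subspaceT => x; rewrite inE /= in_itv /= => /andP[x0 _].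
apply: cvgV; first by rewrite lt0r_neq0 // ltr_wpDl.
by apply: cvgD; [exact: cvg_id|exact: cvg_cst].
Qed.

Lemma within_continuous_affine (A : set R) (a : R) f h : {within A, continuous f} ->
  {within A, continuous h} -> {within A, continuous (fun x => a * f x + h x)}.
Proof.
move=> /subspace_continuousP cf /subspace_continuousP ch.
apply/subspace_continuousP => x xA; apply: cvgD; last exact: ch.
by apply: cvgMl_tmp; exact: cf.
Qed.

Lemma segment_continuous_resolvent_comb (s : seq (R * R)) :
  all (fun cz => 0 < cz.2) s -> {within `[0, 1], continuous (resolvent_comb s)}.
Proof.
elim: s => [_|[c z] s IH /= /andP[z0 /IH cs]].
  by rewrite resolvent_comb_nil; apply: continuous_subspaceT; exact: cst_continuous.
rewrite resolvent_comb_cons.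
by apply: within_continuous_affine => //; exact: segment_continuous_resolvent.
Qed.

Lemma integrable_segment_continuousM f w : {within `[0, 1], continuous f} ->
  mu.-integrable D (EFin \o w) -> mu.-integrable D (EFin \o (fun x => f x * w x)).
Proof.
move=> cf iw; have [M M0 fM] := segment_continuous_bounded ler01 cf.
have mw : measurable_fun D w by apply/measurable_EFinP; exact: measurable_int iw.
apply: (le_integrable _ _ _ (integrableZl _ M iw)) => //.
  apply/measurable_EFinP; apply: measurable_funM => //.
  exact: segment_continuous_measurable.
move=> x xD; rewrite /= lee_fin !normrM ler_wpM2r // (ger0_norm M0).
by apply: fM; exact: subset_itv_oo_cc.
Qed.

Variable w : R -> R.
Hypothesis int_w : mu.-integrable D (EFin \o w).

Definition weighted_Rintegral f := Rintegral mu D (fun x => f x * w x).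

Lemma weighted_Rintegral_affine (a : R) f h : {within `[0, 1], continuous f} ->
  {within `[0, 1], continuous h} -> weighted_Rintegral (fun x => a * f x + h x) =
  a * weighted_Rintegral f + weighted_Rintegral h.
Proof.
move=> cf ch; rewrite /weighted_Rintegral.
have int_fw := integrable_segment_continuousM cf int_w.
have int_hw := integrable_segment_continuousM ch int_w.
under eq_Rintegral do rewrite mulrDl -mulrA.
by rewrite RintegralD ?RintegralZl //; exact: (integrableZl _ a int_fw).
Qed.

Lemma weighted_Rintegral_dist f h (e : R) : {within `[0, 1], continuous f} ->
  {within `[0, 1], continuous h} -> {in `[0, 1], forall x, `|f x - h x| <= e} ->
  `|weighted_Rintegral f - weighted_Rintegral h| <= e * Rintegral mu D (fun x => `|w x|).
Proof.
move=> cf ch fh; rewrite addrC -mulN1r -weighted_Rintegral_affine //.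
have cd := @within_continuous_affine _ (-1) _ _ ch cf.
have int_dw := integrable_segment_continuousM cd int_w.
apply: le_trans (le_normr_Rintegral _ int_dw) _ => //.
rewrite -RintegralZl //; last exact: integrable_norm.
apply: le_Rintegral => //; first exact: integrable_norm.
  exact: (integrableZl _ e (integrable_norm int_w)).
move=> x xD; rewrite normrM ler_wpM2r // mulN1r addrC fh //.
exact: subset_itv_oo_cc.
Qed.

End WeightedIntegral.

Section SeqMean.
Context {R : realType}.
Implicit Types (f h : R -> R) (s : seq R).

Lemma seq_mean_affine s (a : R) f h :
  seq_mean s (fun x => a * f x + h x) = a * seq_mean s f + seq_mean s h.
Proof. by rewrite /seq_mean big_split /= -mulr_sumr mulrDr mulrCA. Qed.

Lemma seq_mean_dist s f h (e : R) : 0 <= e ->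
  {in s, forall x, `|f x - h x| <= e} -> `|seq_mean s f - seq_mean s h| <= e.
Proof.
move=> e0 fh; rewrite /seq_mean -mulrBr -sumrB normrM normfV normr_nat.
have [s0|s_gt0] := posnP (size s); first by rewrite (size0nil s0) big_nil normr0 mulr0.
rewrite ler_pdivrMl ?ltr0n //; apply: le_trans (ler_norm_sum _ _ _) _.
apply: (@le_trans _ _ (\sum_(x <- s) e)); first by rewrite !big_seq; exact: ler_sum.
by rewrite big_const_seq count_predT iter_addr_0 mulr_natl.
Qed.

End SeqMean.

Section StieltjesContinuity.
Context {R : realType}.
Local Notation mu := (@lebesgue_measure R).
Local Notation D := (`]0%R, 1%R[%classic : set R).
Variables (r : nat -> seq R) (w : R -> R).
Hypotheses (r01 : forall k, {in r k, forall x, x \in `[0, 1]})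
  (int_w : mu.-integrable D (EFin \o w)).
Hypothesis cvg_resolvent : forall z, 0 < z ->
  seq_mean (r k) (fun x => (x + z)^-1) @[k --> \oo] -->
  weighted_Rintegral w (fun x => (x + z)^-1).

Lemma cvg_seq_mean_resolvent_comb (s : seq (R * R)) : all (fun cz => 0 < cz.2) s ->
  seq_mean (r k) (resolvent_comb s) @[k --> \oo] -->
  weighted_Rintegral w (resolvent_comb s).
Proof.
elim: s => [_|[c z] s IH /= /andP[z0 s0]].
  rewrite resolvent_comb_nil /weighted_Rintegral /Rintegral.
  rewrite integral0_eq => [/=|x _]; last by rewrite mul0r.
  under eq_fun do rewrite /seq_mean big1 // mulr0.
  exact: cvg_cst.
rewrite resolvent_comb_cons weighted_Rintegral_affine //; last first.
- exact: segment_continuous_resolvent_comb.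
- exact: segment_continuous_resolvent.
under eq_fun do rewrite seq_mean_affine.
by apply: cvgD; [apply: cvgMl_tmp; exact: cvg_resolvent|exact: IH].
Qed.

Lemma cvg_seq_mean_continuous (f : R -> R) : {within `[0, 1], continuous f} ->
  seq_mean (r k) f @[k --> \oo] --> weighted_Rintegral w f.
Proof.
move=> cf; apply/cvgrPdist_lt => e e0.
pose M := Rintegral mu D (fun x => `|w x|).
have M0 : 0 <= M by apply: Rintegral_ge0.
have d0 : 0 < e / (2 * (M + 1)) by rewrite divr_gt0 // mulr_gt0 // ltr_wpDl.
have eE : e = 2 * (e / (2 * (M + 1))) * (M + 1).
  by field; rewrite lt0r_neq0 // ltr_wpDl.
move: (e / _) d0 eE => d d0 ->.
have [s s0 fs] := resolvent_approximable_continuous cf d0.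
have int_dist :=
  weighted_Rintegral_dist int_w cf (segment_continuous_resolvent_comb s0) fs.
near=> k.
have comb_dist : `|weighted_Rintegral w (resolvent_comb s) -
    seq_mean (r k) (resolvent_comb s)| < d.
  by near: k; move/cvgrPdist_lt : (cvg_seq_mean_resolvent_comb s0); exact.
have mean_dist : `|seq_mean (r k) f - seq_mean (r k) (resolvent_comb s)| <= d.
  by apply: seq_mean_dist => [|x /r01 /fs //]; exact: ltW.
apply: le_lt_trans (ler_distD (seq_mean (r k) (resolvent_comb s)) _ _) _.
rewrite [X in _ + X]distrC.
have := ler_distD (weighted_Rintegral w (resolvent_comb s)) (weighted_Rintegral w f)
  (seq_mean (r k) (resolvent_comb s)).
by move: int_dist comb_dist mean_dist (mulr_ge0 (ltW d0) M0); rewrite -/M; lra.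
Unshelve. all: by end_near. Qed.

End StieltjesContinuity.

(** * The limit *)

Section DensityIntegral.
Context {R : realType}.
Local Notation mu := (@lebesgue_measure R).
Local Notation D := (`]0%R, 1%R[%classic : set R).

Lemma Rintegral_cc_oo_setD1 (a b r : R) (h h' : R -> R) : measurable_fun `]a, b[ h' ->
  {in `]a, b[%classic `\ r, h =1 h'} ->
  Rintegral mu `[a, b] h = Rintegral mu `]a, b[ h'.
Proof.
move=> mh' hh'; have mabr : measurable (`]a, b[%classic `\ r) by exact: measurableD.
have mh'r : measurable_fun (`]a, b[%classic `\ r) h'.
  by apply: measurable_funS mh' => //; exact: subDsetl.
have mhr : measurable_fun (`]a, b[%classic `\ r) h.
  by apply: eq_measurable_fun mh'r => x /hh'.
have mh : measurable_fun `]a, b[ h by exact: measurable_fun_setD1 mhr.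
rewrite /Rintegral; congr fine.
rewrite -integral_itv_bndo_bndc; last first.
  by apply/measurable_EFinP; exact/measurable_fun_itv_obnd_cbndP.
rewrite -integral_itv_obnd_cbnd; last exact/measurable_EFinP.
rewrite -(@integral_setD1 _ _ r) //; last exact/measurable_EFinP.
rewrite -[RHS](@integral_setD1 _ _ r) //; last exact/measurable_EFinP.
by apply: eq_integral => x /hh' ->.
Qed.

Variables (g V : R).
Hypotheses (g_gt0 : 0 < g) (g_le1 : g <= 1) (V_gt1 : 1 < V).

Lemma measurable_qMP_angle : measurable_fun D (fun x => qMP_angle g V x / x).
Proof.
apply: open_continuous_measurable_fun; first exact: interval_open.
move=> x; rewrite inE /= in_itv /= => /andP[x0 x1].
apply: cvgM; last exact: inv_continuous (lt0r_neq0 x0).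
apply: (@continuous_comp _ _ _ (qMP_cos g V) acos_clip); last exact: continuous_acos_clip.
apply: cvgM; first by apply: cvgB; [exact: cvg_cst|apply: cvgMr_tmp; exact: cvg_id].
apply: cvgV; first by rewrite mulf_neq0 // lt0r_neq0 // sqrtr_gt0 mulr_gt0 // subr_gt0.
apply: cvgMl_tmp; apply: (@cvg_comp _ _ _ (fun x : R => g * (1 - x)) Num.sqrt).
  by apply: cvgMl_tmp; apply: cvgB; [exact: cvg_cst|exact: cvg_id].
exact: sqrt_continuous.
Qed.

(* On (0, 1) the factor [(x + 1)^-1] is bounded below, so the value of the Stieltjes
   transform at 1 bounds the integral. *)
Lemma integrable_qMP_angle :
  mu.-integrable D (EFin \o (fun x => qMP_angle g V x / x)).
Proof.
have mres : measurable_fun D (fun x => (x + 1)^-1 * (qMP_angle g V x / x)).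
  apply: measurable_funM; last exact: measurable_qMP_angle.
  by apply: segment_continuous_measurable; exact: segment_continuous_resolvent.
have int_res : mu.-integrable D (EFin \o (fun x => (x + 1)^-1 * (qMP_angle g V x / x))).
  apply/integrableP; split; first exact/measurable_EFinP.
  by rewrite /= integral_fin_num_abs // integral_qMP_angle.
apply: (le_integrable _ _ _ (integrableZl _ 2 int_res)) => //.
  by apply/measurable_EFinP; exact: measurable_qMP_angle.
move=> x /=; rewrite in_itv /= => /andP[x0 x1].
move: (qMP_angle g V x / x) => y.
rewrite lee_fin mulrA normrM ler_peMl // ger0_norm ?divr_ge0 ?addr_ge0 ?(ltW x0) //.
by rewrite ler_pdivlMr; lra.
Qed.

Variable lam : R.
Hypothesis lam_gt0 : 0 < lam.

Let angle_weightE : (fun x => qMP_angle g V x / (pi * lam * x)) =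
  (fun x => (pi * lam)^-1 * (qMP_angle g V x / x)).
Proof. by apply: funext => x; rewrite invfM mulrCA. Qed.

Lemma integrable_angle_weight :
  mu.-integrable D (EFin \o (fun x => qMP_angle g V x / (pi * lam * x))).
Proof. rewrite angle_weightE; exact: (integrableZl _ _ integrable_qMP_angle). Qed.

Lemma weighted_Rintegral_resolvent z : 0 < z ->
  weighted_Rintegral (fun x => qMP_angle g V x / (pi * lam * x)) (fun x => (x + z)^-1) =
  ln (resolvent_root g z V) / (lam * z).
Proof.
move=> z0; rewrite angle_weightE /weighted_Rintegral.
under eq_Rintegral do rewrite mulrCA.
rewrite RintegralZl //; last first.
  apply: integrable_segment_continuousM integrable_qMP_angle.
  exact: segment_continuous_resolvent.
rewrite /Rintegral integral_qMP_angle //=.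
move: (pi : R) (lt0r_neq0 (pi_gt0 R)) => p p0.
by field; rewrite p0 !lt0r_neq0.
Qed.

End DensityIntegral.

Lemma Rintegral_qMP_density {R : realType} (c lam : R) (f : R -> R) :
  0 <= c -> 0 < lam -> {within `[0, 1], continuous f} ->
  Rintegral lebesgue_measure `[0, 1] (fun x => f x * qMP_density c lam x) =
  weighted_Rintegral
    (fun x => qMP_angle (expR (- (lam * c))) (expR lam) x / (pi * lam * x)) f.
Proof.
move=> c0 lam0 cf; have g0 := expR_gt0 (- (lam * c)).
have g1 : expR (- (lam * c)) <= 1 by rewrite expR_le1 oppr_le0 mulr_ge0 // ltW.
have V1 : 1 < expR lam by rewrite expR_gt1.
apply: (@Rintegral_cc_oo_setD1 _ _ _ (qMP_b c lam)).
  apply: measurable_funM; first exact: segment_continuous_measurable.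
  by apply/measurable_EFinP; apply: measurable_int (integrable_angle_weight g0 g1 V1 lam).
move=> x; rewrite inE => -[/=]; rewrite in_itv /= => /andP[x0 x1] /eqP xb.
by rewrite qMP_densityE.
Qed.

Lemma onem_expRN_bounds {R : realType} (y : R) : 0 <= y ->
  y / (1 + y) <= 1 - expR (- y) <= y.
Proof.
move=> y0; have y1 : 0 < 1 + y by rewrite ltr_wpDr.
rewrite lerBlDr -lerBlDl expR_ge1Dx andbT.
have -> : y / (1 + y) = 1 - (1 + y)^-1 by field; rewrite lt0r_neq0.
by rewrite lerD2l lerN2 expRN lef_pV2 ?posrE ?expR_gt0 ?expR_ge1Dx.
Qed.

Section QParameters.
Context {R : realType}.
Variables (c : R) (d : nat) (lam : R) (n N : nat -> nat).
Hypotheses (c_ge0 : 0 <= c) (lam_gt0 : 0 < lam) (N_gt0 : forall k, (0 < N k)%N).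
Hypotheses (cvg_n : ((n k)%:R : R) @[k --> \oo] --> +oo)
  (cvg_nN : (n k)%:R / (N k)%:R @[k --> \oo] --> (1 : R)).
Let q k : R := expR (- (lam / (N k)%:R)).
Let a k : R := expR (- (lam / (N k)%:R) * (c * (N k)%:R + d%:R)).

Let NR_neq0 k : (N k)%:R != 0 :> R.
Proof. by rewrite pnatr_eq0 -lt0n. Qed.

Lemma qparam_itv k : 0 < q k < 1.
Proof. by rewrite expR_gt0 expR_lt1 oppr_lt0 divr_gt0 // ltr0n. Qed.

Lemma aparam_qparam_lt1 k : a k * q k < 1.
Proof.
have /andP[q0 q1] := qparam_itv k; apply: le_lt_trans q1.
rewrite ler_piMl ?(ltW q0) // expR_le1 mulNr oppr_le0.
by rewrite mulr_ge0 ?divr_ge0 ?addr_ge0 ?mulr_ge0 // ltW.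
Qed.

Lemma cvg_invN : ((N k)%:R^-1 : R) @[k --> \oo] --> (0 : R).
Proof.
rewrite -(mulr0 (1 : R)).
apply: (@cvg_trans _ (((n k)%:R / (N k)%:R * (n k)%:R^-1 : R) @[k --> \oo])).
  apply: near_eq_cvg; near=> k.
  have n0 : 0 < (n k)%:R :> R by near: k; move/cvgryPgt : cvg_n; exact.
  by field; rewrite NR_neq0 lt0r_neq0.
apply: cvgM => //; apply/gtr0_cvgV0 => //.
by near=> k; near: k; move/cvgryPgt : cvg_n; exact.
Unshelve. all: by end_near. Qed.

Lemma cvg_qparam : q k @[k --> \oo] --> (1 : R).
Proof.
rewrite -[X in _ --> X]expR0; apply: cvg_expR; rewrite -oppr0 -(mulr0 lam).
by apply: cvgN; apply: cvgMl_tmp; exact: cvg_invN.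
Qed.

Lemma cvg_aparam : a k @[k --> \oo] --> expR (- (lam * c)).
Proof.
apply: cvg_expR; rewrite -[X in _ --> X]subr0 -(mulr0 (lam * d%:R)).
under eq_fun => k.
  rewrite (_ : - _ * _ = - (lam * c) - lam * d%:R * (N k)%:R^-1); last by field.
  over.
by apply: cvgB; [exact: cvg_cst|apply: cvgMl_tmp; exact: cvg_invN].
Qed.

Lemma cvg_qparamXn : q k ^+ n k @[k --> \oo] --> expR (- lam).
Proof.
under eq_fun do rewrite /q -expRM_natr mulNr mulrAC -mulrA.
by apply: cvg_expR; apply: cvgN; rewrite -[X in _ --> X]mulr1; exact: cvgMl_tmp.
Qed.

Lemma cvg_onem_qparam_mul_n : (1 - q k) * (n k)%:R @[k --> \oo] --> lam.
Proof.
apply: (@squeeze_cvgr _ _ _ _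
  (fun k => lam * ((n k)%:R / (N k)%:R) * (1 + lam * (N k)%:R^-1)^-1)
  (fun k => lam * ((n k)%:R / (N k)%:R))).
- apply: nearW => k; have y0 : 0 <= lam / (N k)%:R by rewrite divr_ge0 // ltW.
  have /andP[lo hi] := onem_expRN_bounds y0.
  rewrite [(n k)%:R / _]mulrC mulrA [X in X <= _]mulrAC.
  by rewrite !ler_wpM2r.
- rewrite -[X in _ --> X](_ : lam * 1 * (1 + lam * 0)^-1 = lam); last first.
    by rewrite mulr0 addr0 invr1 !mulr1.
  apply: cvgM; first exact: cvgMl_tmp.
  apply: cvgV; first by rewrite mulr0 addr0 oner_neq0.
  by apply: cvgD; [exact: cvg_cst|apply: cvgMl_tmp; exact: cvg_invN].
- by rewrite -[X in _ --> X]mulr1; exact: cvgMl_tmp.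
Qed.

End QParameters.

Unset Implicit Arguments.

Theorem theorem1p2 (R : realType) (c : R) (d : nat) (lam : R)
  (hc : 0 <= c) (hlam : 0 < lam)
  (n N : nat -> nat)
  (hN : forall k, (0 < N k)%N)
  (hn : ((n k)%:R : R) @[k --> \oo] --> +oo)
  (hnN : (n k)%:R / (N k)%:R @[k --> \oo] --> (1 : R))
  (f : R -> R) (hf : {within `[0, 1], continuous f}) :
  zero_counting_integral (n k)
    (little_qLaguerre
       (expR (- (lam / (N k)%:R) * (c * (N k)%:R + d%:R)))
       (expR (- (lam / (N k)%:R))) (n k)) f
  @[k --> \oo]
  --> Rintegral lebesgue_measure `[0, 1] (fun x => f x * qMP_density c lam x).
Proof.
rewrite Rintegral_qMP_density //.
have q01 := qparam_itv hlam hN; have aq1 := aparam_qparam_lt1 d hc hlam hN.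
have /choice[r rP] k := little_qLaguerre_zeros (andP (q01 k)).1 (andP (q01 k)).2
  (expR_gt0 _) (aq1 k) (n k).
have r01 k : {in r k, forall x, 0 < x < 1} by have [] := rP k.
under eq_fun => k.
  have [size_r uniq_r _ ->] := rP k; rewrite -{1}size_r.
  rewrite zero_counting_integral_prod_onem //; last by apply/negP => /r01; rewrite ltxx.
  over.
have g0 := expR_gt0 (- (lam * c)); have V1 : 1 < expR lam by rewrite expR_gt1.
have g1 : expR (- (lam * c)) <= 1 by rewrite expR_le1 oppr_le0 mulr_ge0 // ltW.
apply: cvg_seq_mean_continuous hf => [k x /r01/andP[x0 x1]||z z0].
- by rewrite in_itv /= !ltW.
- exact: integrable_angle_weight g0 g1 V1 lam.
rewrite weighted_Rintegral_resolvent // -[expR lam]invrK -expRN.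
apply: (cvg_seq_mean_resolvent q01 _ aq1 _ r01 _ (ltW g0) g1 (expR_gt0 _) _ z0
  (cvg_aparam d hN hn hnN) (cvg_qparam lam hN hn hnN) (cvg_qparamXn hnN)
  (cvg_onem_qparam_mul_n hlam hN hn hnN) hlam) => [k|k|k|];
  by [exact: expR_gt0 | case: (rP k) | rewrite expR_le1 oppr_le0 ltW].
Qed.
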